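(* Fix $w\in S_n$ and $k\in[n]$, and let $\sigma\in S_{n-1}$ be the pattern whose Rothe diagram $D(\sigma)$ is obtained from $D(w)$ by removing row $k$ and column $w_k$ (and reindexing the remaining rows and columns by $[n-1]$ preserving order). Then $$\mathfrak{S}_w(x_1,\dots,x_n)=M(x_1,\dots,x_n)\,\mathfrak{S}_\sigma(x_1,\dots,\widehat{x_k},\dots,x_n)+F(x_1,\dots,x_n),$$ where $F\in\mathbb{Z}_{\ge 0}[x_1,\dots,x_n]$ and $$M(x_1,\dots,x_n)=\Big(\prod_{(k,i)\in D(w)}x_k\Big)\Big(\prod_{(i,w_k)\in D(w)}x_i\Big).$$
   Context: For $w\in S_n$, the Schubert polynomial $\mathfrak{S}_w$ is defined by $\mathfrak{S}_{w_0}=x_1^{n-1}x_2^{n-2}\cdots x_{n-1}$ for the longest permutation $w_0=n\,(n-1)\cdots 1$, and $\mathfrak{S}_w=\partial_i\mathfrak{S}_{ws_i}$ whenever $w_i<w_{i+1}$, where $\partial_i f=(f-s_if)/(x_i-x_{i+1})$ and $s_i$ swaps $x_i,x_{i+1}$. The Rothe diagram of $w$ is $D(w)=\{(i,j)\in[n]\times[n]: i<w^{-1}(j),\ j<w_i\}$, where $(i,j)$ denotes the box in row $i$, column $j$. The permutation $\sigma$ is the standardization of $w_1\cdots\widehat{w_k}\cdots w_n$. The notation $\mathfrak{S}_\sigma(x_1,\dots,\widehat{x_k},\dots,x_n)$ means $\mathfrak{S}_\sigma$ evaluated at the $n-1$ variables $x_1,\dots,x_{k-1},x_{k+1},\dots,x_n$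 in this order. *)

(* Defs.v *)
From HB Require Import structures.
From mathcomp Require Import all_boot all_order all_algebra all_fingroup.
From mathcomp Require Import mpoly.
From Stdlib Require Import ClassicalEpsilon.

Set Implicit Arguments.
Unset Strict Implicit.
Unset Printing Implicit Defensive.

Import GRing.Theory.
Local Open Scope ring_scope.

(* Conventions: rows, columns and variables are 0-indexed, i.e. index
   i : 'I_n stands for the paper's i+1 in [n]; variable x_{i+1} is 'X_i. *)

Definition rothe n (w : 'S_n) : {set 'I_n * 'I_n} :=
  [set ij : 'I_n * 'I_n | (ij.1 < (w^-1)%g ij.2)%N && (ij.2 < w ij.1)%N].

(* the index i+1 as an element of 'I_n (meaningful when i.+1 < n) *)
Definition nexti n (i : 'I_n) : 'I_n := insubd i i.+1.

Definition stp n (i : 'I_n) : 'S_n := tperm i (nexti i).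

Definition spoly n (i : 'I_n) (f : {mpoly int[n]}) : {mpoly int[n]} :=
  msym (stp i) f.

(* divided difference: the polynomial g with (x_i - x_{i+1}) g = f - s_i f
   (this quotient always exists in Z[x]; 0 as an unused default otherwise) *)
Definition ddiff n (i : 'I_n) (f : {mpoly int[n]}) : {mpoly int[n]} :=
  epsilon (inhabits 0)
    (fun g : {mpoly int[n]} => ('X_i - 'X_(nexti i)) * g = f - spoly i f).

Definition schub_top n : {mpoly int[n]} := \prod_(i < n) 'X_i ^+ (n.-1 - i).

Definition ascent n (w : 'S_n) : option 'I_n :=
  [pick i : 'I_n | (i.+1 < n)%N && (w i < w (nexti i))%N].

(* S_w = d_i S_{w s_i} for an ascent i of w, S_{w0} = top monomial.
   (w s_i)(j) = w(s_i(j)) is (stp i * w)%g in mathcomp's convention.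
   Fuel 'C(n,2) suffices: each step raises the length by one, and w0 is the
   only permutation without ascent. *)
Fixpoint schub_aux n (fuel : nat) (w : 'S_n) : {mpoly int[n]} :=
  match fuel with
  | 0 => schub_top n
  | fuel'.+1 =>
      match ascent w with
      | None => schub_top n
      | Some i => ddiff i (schub_aux fuel' (stp i * w)%g)
      end
  end.

Definition schubert n (w : 'S_n) : {mpoly int[n]} := schub_aux 'C(n, 2) w.

Definition skipvar n (k : 'I_n.+1) (f : {mpoly int[n]}) : {mpoly int[n.+1]} :=
  mmap (@mpolyC _ _) (fun i : 'I_n => 'X_(lift k i)) f.

Definition Mfactor n (w : 'S_n) (k : 'I_n) : {mpoly int[n]} :=
  (\prod_(i < n | (k, i) \in rothe w) 'X_k) *
  (\prod_(i < n | (i, w k) \in rothe w) 'X_i).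

(* Main.v *)
Require Import Defs.
From HB Require Import structures.
From mathcomp Require Import all_boot all_order all_algebra all_fingroup.
From mathcomp Require Import mpoly zify ring.
From Stdlib Require Import ClassicalEpsilon.

Set Implicit Arguments.
Unset Strict Implicit.
Unset Printing Implicit Defensive.

Import Order.TTheory GRing.Theory Num.Theory.
Local Open Scope ring_scope.

(* Let Y be the generic upper triangular matrix. For a filling T of the Rothe
   diagram of w, which assigns rows to the boxes of each column, let Delta w T be
   the product over the columns of the corresponding minors of Y, and let
   rk w al be the rank of the Delta w T whose filling has weight al.

   Kraskiewicz and Pragacz: the coefficient of x^al in the Schubert polynomial of
   w is rk w al. Monk's rule writes a multiple of S_w as the sum of S_v over
   covers v of w. Explicit lifts of the generators Delta v T to combinations of
   the Delta w T, kept independent by the top coefficients of the column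
   operations "column b += t * column a", show that rk satisfies the same rule
   as an inequality. When i is a left-to-right minimum of w the rule reads
   x_i S_w = sum of S_v, and downward induction from the longest permutation gives
   S_w <= rk w. In general the inequality, read upwards from the identity, forces
   equality.

   Once S is a rank, the theorem is immediate: multiplying by the leading minor
   of column w_k, and giving the rows k of all other columns to themselves, turns
   independent Delta sigma T into independent Delta w T, as one sees by setting
   y_kk = 1 and the other entries of row and column k to 0. *)


(** * Divided differences *)

(** Apart from the identity permutation, ranks are only ever bounded from below: independent lifts
    can be exhibited, while a direct upper bound for the rank of all Delta w T is out of reach. The
    upper bound comes from comparing sums. Adding Monk's rule over the variables x_c with c <= q
    cancels its negative terms and leaves: the sum of x_c S_u equals the sum of S_v over the covers
    v of u that straddle q. Ranks satisfy this with >= in place of equality, and S_v <= rk v for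
    each v; so once S_u = rk u there is no room for any S_v < rk v. The factor x_c is realized by
    vectors with an entry for each row c; the functional that tests them pairs entry c with Y_ca.
    Scalars are rational because a lift returns Delta v T only up to a product of two factorials.
    Staying inside S_n has a price: Monk's rule for x_c can leave S_n unless a larger value stands
    to the right of position c. Hence q is chosen so that the maximum of u lies to its right. *)

Section Quotients.
Variables (A : idomainType) (s t : A -> A).
Hypotheses (sM : forall f g, s (f * g) = s f * s g) (sB : forall f g, s (f - g) = s f - s g).
Hypotheses (tM : forall f g, t (f * g) = t f * t g) (tB : forall f g, t (f - g) = t f - t g).

(** Multiplied by [x * y], both sides become [f - s f - t f + s (t f)]. The maps [s] and [t] stand
    for swaps of variables, and quotients enter only through their defining equations. *)
Lemma quotients_commute (x y f d1 d2 d21 d12 : A) :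
  (forall f, s (t f) = t (s f)) -> x != 0 -> y != 0 -> t x = x -> s y = y ->
  x * d1 = f - s f -> y * d2 = f - t f ->
  y * d21 = d1 - t d1 -> x * d12 = d2 - s d2 -> d12 = d21.
Proof.
move=> st x0 y0 tx sy e1 e2 e21 e12; apply: (mulfI x0); apply: (mulfI y0).
have h1 : x * t d1 = t f - t (s f) by rewrite -{1}tx -tM e1 tB.
have h2 : y * s d2 = s f - s (t f) by rewrite -{1}sy -sM e2 sB.
rewrite e12 mulrBr e2 h2 mulrCA e21 mulrBr e1 h1 st; ring.
Qed.

(* Both sides become the alternating sum of f over the six permutations of
   the three variables, divided by the Vandermonde determinant. *)
Lemma quotients_braid (x y z f d1 d2 d21 d12 d121 d212 : A) :
  involutive s -> involutive t -> (forall f, s (t (s f)) = t (s (t f))) ->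
  x - y != 0 -> y - z != 0 -> x - z != 0 ->
  s x = y -> s y = x -> s z = z -> t x = x -> t y = z -> t z = y ->
  (x - y) * d1 = f - s f -> (y - z) * d2 = f - t f ->
  (y - z) * d21 = d1 - t d1 -> (x - y) * d12 = d2 - s d2 ->
  (x - y) * d121 = d21 - s d21 -> (y - z) * d212 = d12 - t d12 -> d121 = d212.
Proof.
move=> sK tK br xy yz xz sx sy sz tx ty tz e1 e2 e21 e12 e121 e212.
have t1 : (x - z) * t d1 = t f - t (s f) by rewrite -{1}tx -ty -tB -tM e1 tB.
have s2 : (x - z) * s d2 = s f - s (t f) by rewrite -{1}sy -sz -sB -sM e2 sB.
have h21 : (x - y) * (x - z) * ((y - z) * d21) =
    (x - z) * (f - s f) - (x - y) * (t f - t (s f)).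
  by rewrite e21 -t1 -e1; ring.
have h12 : (y - z) * (x - z) * ((x - y) * d12) =
    (x - z) * (f - t f) - (y - z) * (s f - s (t f)).
  by rewrite e12 -s2 -e2; ring.
have s21 : (y - x) * (y - z) * ((x - z) * s d21) =
    (y - z) * (s f - f) - (y - x) * (s (t f) - s (t (s f))).
  by have := congr1 s h21; rewrite !(sM, sB) sx sy sz sK.
have t12 : (z - y) * (x - y) * ((x - z) * t d12) =
    (x - y) * (t f - f) - (z - y) * (t (s f) - t (s (t f))).
  by have := congr1 t h12; rewrite !(tM, tB) tx ty tz tK.
apply: (mulfI xy); rewrite e121; apply: (mulfI yz).
rewrite [RHS]mulrCA e212; apply: (mulfI xy); apply: (mulfI yz); apply: (mulfI xz).
transitivity ((y - z) * ((x - y) * (x - z) * ((y - z) * d21)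
    + (y - x) * (y - z) * ((x - z) * s d21))); first by ring.
transitivity ((x - y) * ((y - z) * (x - z) * ((x - y) * d12)
    + (z - y) * (x - y) * ((x - z) * t d12))); last by ring.
rewrite h21 s21 h12 t12 br; ring.
Qed.

End Quotients.

Section DividedDifferences.
Variable n : nat.
Implicit Types (i j : 'I_n) (f g : {mpoly int[n]}) (m : 'X_{1..n}).

Lemma nextiE i : (i.+1 < n)%N -> nexti i = i.+1 :> nat.
Proof. by move=> h; rewrite /nexti val_insubd h. Qed.

Lemma nexti_neq i : (i.+1 < n)%N -> i != nexti i.
Proof. by move=> h; rewrite -val_eqE /= nextiE //; lia. Qed.

Lemma spolyX i m : spoly i 'X_[m] = 'X_[[multinom m (stp i l) | l < n]].
Proof. by rewrite /spoly msymX tpermV. Qed.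

Lemma spolyXU i (k : 'I_n) : spoly i 'X_k = 'X_(stp i k).
Proof.
rewrite spolyX; congr 'X_[_]; apply/mnmP => l; rewrite mnmE !mnm1E.
by congr nat_of_bool; apply/eqP/eqP => [->|<-]; rewrite tpermK.
Qed.

Lemma spolyK i : involutive (spoly i).
Proof. by move=> f; rewrite /spoly -msymMm tperm2 msym1m. Qed.

Lemma spolyM i f g : spoly i (f * g) = spoly i f * spoly i g.
Proof. exact: msymM. Qed.

Lemma spolyD i f g : spoly i (f + g) = spoly i f + spoly i g.
Proof. exact: msymD. Qed.

Lemma spolyB i f g : spoly i (f - g) = spoly i f - spoly i g.
Proof. exact: msymB. Qed.

Lemma spoly_xi i : spoly i 'X_i = 'X_(nexti i).
Proof. by rewrite spolyXU tpermL. Qed.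

Lemma spoly_xj i : spoly i 'X_(nexti i) = 'X_i.
Proof. by rewrite spolyXU tpermR. Qed.

Lemma subX_neq0 i j : i != j -> 'X_i - 'X_j != 0 :> {mpoly int[n]}.
Proof.
move=> ne; apply/eqP => /(congr1 (mcoeff U_(i)))/eqP.
by rewrite mcoeffB !mcoeffXU eqxx [j == i]eq_sym (negbTE ne) mcoeff0.
Qed.

(** Homogeneous of degree d and supported on divisors of [schub_top n]. In particular the last
    variable is absent, which the proof of Monk's rule needs. *)
Definition staircase d f := forall m, m \in msupp f ->
  mdeg m = d /\ forall k : 'I_n, (m k <= n.-1 - k)%N.

Lemma staircaseD d f g : staircase d f -> staircase d g -> staircase d (f + g).
Proof.
by move=> hf hg m /msuppD_le; rewrite mem_cat => /orP[/hf|/hg].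
Qed.

Lemma staircaseN d f : staircase d f -> staircase d (- f).
Proof. by move=> hf m; rewrite (perm_mem (msuppN f)) => /hf. Qed.

Lemma staircaseZ d c f : staircase d f -> staircase d (c *: f).
Proof. by move=> hf m /msuppZ_le /hf. Qed.

Lemma staircase0 d : staircase d 0.
Proof. by move=> m; rewrite msupp0. Qed.

Lemma staircase_sum d (I : Type) (r : seq I) (P : pred I) F :
  (forall k, P k -> staircase d (F k)) -> staircase d (\sum_(k <- r | P k) F k).
Proof.
by move=> h; elim/big_rec: _ => [|k f Pk]; [exact: staircase0|apply/staircaseD/h].
Qed.

Lemma ddiff_ex_monomial i m : (i.+1 < n)%N -> exists g,
  ('X_i - 'X_(nexti i)) * g = 'X_[m] - spoly i 'X_[m] /\
  ((forall k : 'I_n, (m k <= n.-1 - k)%N) -> staircase (mdeg m).-1 g).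
Proof.
move=> hi; set j := nexti i; have nj : j = i.+1 :> nat by rewrite /j nextiE.
have ij : i != j by exact: nexti_neq.
(* The part of [m] symmetric in x_i and x_j. What remains is a pure power of one of the two
   variables, whose divided difference is a geometric sum up to sign. *)
pose m0 := [multinom if (l == i) || (l == j) then minn (m i) (m j) else m l | l < n].
have m0s : [multinom m0 (stp i l) | l < n] = m0.
  apply/mnmP => l; rewrite !mnmE /stp -/j.
  by case: tpermP => [->|->|/eqP/negbTE-> /eqP/negbTE->] //; rewrite ?eqxx ?orbT.
have sX k : spoly i ('X_[m0] * k) = 'X_[m0] * spoly i k by rewrite spolyM spolyX m0s.
pose k := (maxn (m i) (m j) - minn (m i) (m j))%N.
pose g := \sum_(t < k) 'X_[int, m0 + U_(i) *+ (k.-1 - t) + U_(j) *+ t].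
have gE : ('X_i - 'X_j) * g = 'X_[m0] * ('X_i ^+ k - 'X_j ^+ k).
  rewrite subrXX mulrCA; congr (_ * _); rewrite /g mulr_sumr.
  by apply: eq_bigr => t _; rewrite !mpolyXD !mpolyXn -mulrA -subn1 -subnDA add1n.
(* In [g] the exponents at i and j stay below the larger of [m i] and [m j], so the bound at j,
   smaller by one than that at i, still holds. *)
have gS : (forall k : 'I_n, (m k <= n.-1 - k)%N) -> staircase (mdeg m).-1 g.
  move=> hm; apply: staircase_sum => t _ m'; rewrite msuppX inE => /eqP->.
  have dm0 : (mdeg m0 + k = mdeg m)%N.
    rewrite !mdegE (bigD1 i) //= (bigD1 j) 1?eq_sym //=.
    rewrite [in RHS](bigD1 i) //= [in RHS](bigD1 j) 1?eq_sym //=.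
    rewrite !mnmE !eqxx orbT /=.
    under eq_bigr => l /andP[h1 h2] do rewrite mnmE (negbTE h1) (negbTE h2) /=.
    by rewrite /k; lia.
  have tk := ltn_ord t; split.
    by rewrite !mdegD !mdegMn !mdeg1; lia.
  move=> l; rewrite !mnmDE !mulmnE !mnm1E mnmE.
  have hmi := hm i; have hmj := hm j; have hml := hm l.
  case: (eqVneq l i) => [->|li] /=.
    by rewrite [j == i]eq_sym (negbTE ij); rewrite /k in tk *; lia.
  case: (eqVneq l j) => [->|lj] /=; last by lia.
  by rewrite /k in tk *; lia.
case: (leqP (m j) (m i)) => hab.
  exists g; split => //; rewrite gE.
  have -> : 'X_[m] = 'X_[m0] * 'X_i ^+ k :> {mpoly int[n]}.
    rewrite mpolyXn -mpolyXD; congr 'X_[_]; apply/mnmP => l.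
    rewrite mnmDE mulmnE mnm1E mnmE.
    case: (eqVneq l i) => [->|li] /=; first by rewrite /k; lia.
    by case: (eqVneq l j) => [->|lj]; rewrite /k; lia.
  by rewrite sX /spoly rmorphXn /= -/(spoly i _) spoly_xi mulrBr.
exists (- g); split; last by move=> /gS /staircaseN.
rewrite mulrN gE.
have -> : 'X_[m] = 'X_[m0] * 'X_j ^+ k :> {mpoly int[n]}.
  rewrite mpolyXn -mpolyXD; congr 'X_[_]; apply/mnmP => l.
  rewrite mnmDE mulmnE mnm1E mnmE.
  case: (eqVneq l i) => [->|li] /=; first by rewrite [j == i]eq_sym (negbTE ij) /k; lia.
  by case: (eqVneq l j) => [->|lj]; rewrite /k; lia.
by rewrite sX /spoly rmorphXn /= -/(spoly i _) spoly_xj -mulrN opprB mulrBr.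
Qed.

Lemma ddiff_ex i f : (i.+1 < n)%N -> exists g,
  ('X_i - 'X_(nexti i)) * g = f - spoly i f /\
  (forall d, staircase d f -> staircase d.-1 g).
Proof.
move=> hi; pose G m := proj1_sig (constructive_indefinite_description _
  (ddiff_ex_monomial m hi)).
have GP m : ('X_i - 'X_(nexti i)) * G m = 'X_[m] - spoly i 'X_[m] /\
  ((forall k : 'I_n, (m k <= n.-1 - k)%N) -> staircase (mdeg m).-1 (G m)).
  exact: (proj2_sig (constructive_indefinite_description _ (ddiff_ex_monomial m hi))).
exists (\sum_(m <- msupp f) f@_m *: G m); split.
  have -> : spoly i f = \sum_(m <- msupp f) f@_m *: spoly i 'X_[m].
    rewrite [in LHS](mpolyE f) /spoly raddf_sum.
    by apply: eq_bigr => m _; rewrite /= msymZ.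
  rewrite [X in _ = X - _](mpolyE f) -sumrB mulr_sumr.
  by apply: eq_bigr => m _; rewrite -scalerBr -scalerAr (GP m).1.
move=> d hd; rewrite big_seq; apply: staircase_sum => m hm.
by apply: staircaseZ; have [<- hb] := hd m hm; apply: (GP m).2.
Qed.

Lemma ddiffP i f : (i.+1 < n)%N ->
  ('X_i - 'X_(nexti i)) * ddiff i f = f - spoly i f.
Proof.
move=> hi; apply: (epsilon_spec (inhabits 0)
  (fun g => ('X_i - 'X_(nexti i)) * g = f - spoly i f)).
by have [g [hg _]] := ddiff_ex f hi; exists g.
Qed.

Lemma ddiff_uniq i f g : (i.+1 < n)%N ->
  ('X_i - 'X_(nexti i)) * g = f - spoly i f -> ddiff i f = g.
Proof.
move=> hi hg; apply: (mulfI (subX_neq0 (nexti_neq hi))).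
by rewrite ddiffP.
Qed.

Lemma ddiff_staircase i d f : (i.+1 < n)%N ->
  staircase d f -> staircase d.-1 (ddiff i f).
Proof. by move=> hi hf; have [g [/(ddiff_uniq hi)-> ]] := ddiff_ex f hi; apply. Qed.

Lemma ddiff0P i f : (i.+1 < n)%N -> ddiff i f = 0 <-> spoly i f = f.
Proof.
move=> hi; split=> [h|h].
  by have := ddiffP f hi; rewrite h mulr0 => /eqP; rewrite eq_sym subr_eq0 => /eqP.
by apply: ddiff_uniq => //; rewrite h subrr mulr0.
Qed.

Lemma spoly_ddiff i f : (i.+1 < n)%N -> spoly i (ddiff i f) = ddiff i f.
Proof.
move=> hi; apply: (mulfI (subX_neq0 (nexti_neq hi))); rewrite ddiffP //.
have := congr1 (fun p => - spoly i p) (ddiffP f hi).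
rewrite spolyM spolyB spoly_xi spoly_xj -mulNr opprB => ->.
by rewrite spolyB spolyK opprB.
Qed.

Lemma ddiff_ddiff i f : (i.+1 < n)%N -> ddiff i (ddiff i f) = 0.
Proof. by move=> hi; apply/ddiff0P => //; apply: spoly_ddiff. Qed.

Lemma ddiffB i f g : (i.+1 < n)%N -> ddiff i (f - g) = ddiff i f - ddiff i g.
Proof.
by move=> hi; apply: ddiff_uniq => //; rewrite mulrBr !ddiffP // spolyB; ring.
Qed.

Lemma ddiff0 i : (i.+1 < n)%N -> ddiff i 0 = 0.
Proof. by move=> hi; rewrite -[in LHS](subrr 0) ddiffB // subrr. Qed.

Lemma ddiffD i f g : (i.+1 < n)%N -> ddiff i (f + g) = ddiff i f + ddiff i g.
Proof.
by move=> hi; apply: ddiff_uniq => //; rewrite mulrDr !ddiffP // spolyD; ring.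
Qed.

Lemma ddiff_sum i (I : Type) (r : seq I) (P : pred I) F : (i.+1 < n)%N ->
  ddiff i (\sum_(k <- r | P k) F k) = \sum_(k <- r | P k) ddiff i (F k).
Proof. by move=> hi; apply: big_morph; [move=> *; apply: ddiffD|apply: ddiff0]. Qed.

Lemma ddiffXM i (k : 'I_n) f : (i.+1 < n)%N ->
  ddiff i ('X_k * f) = 'X_(stp i k) * ddiff i f + (k == i)%:R * f - (k == nexti i)%:R * f.
Proof.
move=> hi; have ne := nexti_neq hi; apply: ddiff_uniq => //.
rewrite spolyM spolyXU mulrBr mulrDr mulrCA ddiffP // /stp.
case: tpermP => [->|->|/eqP/negbTE-> /eqP/negbTE->].
- by rewrite eqxx (negbTE ne) /=; ring.
- by rewrite eqxx [nexti i == i]eq_sym (negbTE ne) /=; ring.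
- by rewrite /=; ring.
Qed.

Lemma ddiff_comm i j f : (i.+1 < n)%N -> (j.+1 < n)%N -> (i.+1 < j)%N ->
  ddiff i (ddiff j f) = ddiff j (ddiff i f).
Proof.
move=> hi hj hij.
have ni := nextiE hi; have nj := nextiE hj.
have fx (a b : 'I_n) : (a.+1 < n)%N -> (b != a :> nat) -> (b != a.+1 :> nat) -> stp a b = b.
  by move=> ha h1 h2; rewrite tpermD // -val_eqE /= ?nextiE // eq_sym.
have c : (stp i * stp j = stp j * stp i)%g.
  by rewrite conjgC [in X in (_ * X)%g]/stp tpermJ !fx //; lia.
have c' g : spoly i (spoly j g) = spoly j (spoly i g) by rewrite /spoly -!msymMm c.
apply: (quotients_commute (spolyM i) (spolyB i) (spolyM j) (spolyB j) c'
  (subX_neq0 (nexti_neq hi)) (subX_neq0 (nexti_neq hj)) _ _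
  (ddiffP f hi) (ddiffP f hj) (ddiffP _ hj) (ddiffP _ hi)).
- by rewrite spolyB !spolyXU !fx //; lia.
- by rewrite spolyB !spolyXU !fx //; lia.
Qed.

Lemma ddiff_braid i f : (i.+2 < n)%N ->
  ddiff i (ddiff (nexti i) (ddiff i f)) =
  ddiff (nexti i) (ddiff i (ddiff (nexti i) f)).
Proof.
move=> hi; have hi1 : (i.+1 < n)%N by lia.
have nj := nextiE hi1.
have hj1 : ((nexti i).+1 < n)%N by lia.
have nk := nextiE hj1.
have ij : i != nexti i by rewrite -val_eqE /=; lia.
have jk : nexti i != nexti (nexti i) by rewrite -val_eqE /=; lia.
have ik : i != nexti (nexti i) by rewrite -val_eqE /=; lia.
have br g : spoly i (spoly (nexti i) (spoly i g)) =
            spoly (nexti i) (spoly i (spoly (nexti i) g)).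
  rewrite /spoly -!msymMm; congr msym; rewrite /stp; transitivity (tperm i (nexti (nexti i))).
    by rewrite -{1}(tpermV i (nexti i)) -?mulgA -conjgE tpermJ tpermR tpermD.
  by rewrite -{1}(tpermV (nexti i) (nexti (nexti i))) -?mulgA -conjgE tpermJ tpermL
    tpermD // eq_sym.
apply: (quotients_braid (spolyM i) (spolyB i) (spolyM (nexti i)) (spolyB (nexti i))
  (spolyK i) (spolyK (nexti i)) br (subX_neq0 ij) (subX_neq0 jk) (subX_neq0 ik)
  (spoly_xi i) (spoly_xj i) _ _ (spoly_xi _) (spoly_xj _)
  (ddiffP f hi1) (ddiffP f hj1) (ddiffP _ hj1) (ddiffP _ hi1) (ddiffP _ hi1) (ddiffP _ hj1)).
- by rewrite spolyXU tpermD.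
- by rewrite spolyXU tpermD // eq_sym.
Qed.

End DividedDifferences.


(** * Schubert polynomials *)

Section Schubert.
Variable n : nat.
Implicit Types (i j a b : 'I_n) (u w : 'S_n).

Definition inversions w := [set x : 'I_n * 'I_n | (x.1 < x.2)%N && (w x.2 < w x.1)%N].

Definition len w := #|inversions w|.

Lemma ord_val_neq i j : i != j -> (i != j :> nat).
Proof. by []. Qed.

Ltac nat_neq := repeat match goal with
  | H : is_true (negb (@eq_op _ ?x ?y)) |- _ =>
    lazymatch type of x with nat => fail | _ => move/ord_val_neq: H => H end
  | H : ?x = ?y |- _ =>
    lazymatch type of x with nat => fail | bool => fail
    | _ => move/(congr1 (@nat_of_ord n)): H => H end end.

Lemma perm_val_neq w i j : i != j -> (w i != w j :> nat).
Proof. by move=> ij; rewrite val_eqE (inj_eq perm_inj). Qed.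

Variant stp_spec i x : 'I_n -> Prop :=
| StpL of x = i : stp_spec i x (nexti i)
| StpR of x = nexti i : stp_spec i x i
| StpN of (x != i :> nat) & (x != nexti i :> nat) : stp_spec i x x.

Lemma stpP i x : stp_spec i x (stp i x).
Proof. by rewrite /stp; case: tpermP => [||/eqP ? /eqP]; constructor. Qed.

Lemma stpK i : involutive (stp i).
Proof. exact: tpermK. Qed.

Lemma stpM2 i w : (stp i * (stp i * w) = w)%g.
Proof. by rewrite mulgA tperm2 mul1g. Qed.

(** Relabelling positions by [stp i] carries the inversions of w to those of [stp i * w] other than
    the new pair of positions i, i+1. *)
Lemma len_stp i w : (i.+1 < n)%N -> (w i < w (nexti i))%N ->
  len (stp i * w)%g = (len w).+1.
Proof.
move=> hi hw; have nj := nextiE hi.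
pose f (x : 'I_n * 'I_n) := (stp i x.1, stp i x.2).
have fK : involutive f by move=> [a b]; rewrite /f /= !stpK.
have -> : len (stp i * w)%g = #|(i, nexti i) |: [set f x | x in inversions w]|.
  apply: eq_card => -[a b]; rewrite !inE /= !permM xpair_eqE.
  have -> : ((a, b) \in [set f x | x in inversions w]) = (f (a, b) \in inversions w).
    by rewrite -{1}(fK (a, b)) mem_imset //; apply: can_inj fK.
  rewrite inE /=.
  case: (stpP i a) => [->|->|a1 a2]; case: (stpP i b) => [->|->|b1 b2];
    rewrite ?eqxx -?val_eqE /=; lia.
rewrite cardsU1 card_imset; last exact: can_inj fK.
suff -> : (i, nexti i) \notin [set f x | x in inversions w] by [].
apply/imsetP => -[[a b]]; rewrite inE /= => h.
move=> /(congr1 f); rewrite fK {1}/f /= /stp tpermL tpermR => -[e1 e2].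
by move: h; rewrite -e1 -e2; lia.
Qed.

Lemma card_ltn_pairs : #|[set x : 'I_n * 'I_n | (x.1 < x.2)%N]| = 'C(n, 2).
Proof.
rewrite -sum1_card; under eq_bigl => x do rewrite in_set -[(_ < _)%N]andTb.
rewrite -(pair_big_dep xpredT (fun a b : 'I_n => (a < b)%N) (fun _ _ => 1%N)) /=.
rewrite (exchange_big_dep xpredT) //= -triangular_sum big_mkord.
apply: eq_bigr => i _; rewrite sum1_card -[RHS]card_ord.
have le_in : (i <= n)%N by apply: ltnW.
rewrite -(card_image (f := widen_ord le_in)); last by move=> a b [] /val_inj.
apply: eq_card => x; rewrite unfold_in; apply/idP/imageP => [lt_xi|[y _ ->]]; last first.
  exact: (ltn_ord y).
by exists (Ordinal lt_xi) => //; apply: val_inj.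
Qed.

Lemma len_max w : (len w <= 'C(n, 2))%N.
Proof.
by rewrite -card_ltn_pairs; apply/subset_leq_card/subsetP => x; rewrite !inE => /andP[].
Qed.

Lemma ascent_some w i : ascent w = Some i -> (i.+1 < n)%N /\ (w i < w (nexti i))%N.
Proof. by rewrite /ascent; case: pickP => // k /andP[? ?] [<-]. Qed.

Lemma ascent_none w i : ascent w = None -> (i.+1 < n)%N -> (w (nexti i) < w i)%N.
Proof.
rewrite /ascent; case: pickP => // /(_ i) h _ hi.
by move: h (perm_val_neq w (nexti_neq hi)); rewrite hi /=; lia.
Qed.

Lemma ascent_none_anti w : ascent w = None -> forall a b : 'I_n, (a < b)%N -> (w b < w a)%N.
Proof.
move=> h a b; have [d] := ubnP (b - a)%N; elim: d a b => // d IH a b hd ab.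
have ha : (a.+1 < n)%N by apply: leq_ltn_trans (ltn_ord b).
have na := nextiE ha; have ga := ascent_none h ha.
case: (eqVneq (nexti a) b) => [<-//|ne].
have ne' : (nexti a != b :> nat) by [].
by apply: ltn_trans ga; apply: IH; lia.
Qed.

Lemma len_ascent_none w : ascent w = None -> len w = 'C(n, 2).
Proof.
move=> h; rewrite -card_ltn_pairs; apply: eq_card => x; rewrite !inE.
by case: ltnP => //= /(ascent_none_anti h).
Qed.

Lemma schub_aux_fuel f f' w : ('C(n, 2) <= f + len w)%N -> ('C(n, 2) <= f' + len w)%N ->
  schub_aux f w = schub_aux f' w.
Proof.
have stuck v i : ('C(n, 2) <= len v)%N -> ascent v = Some i -> False.
  by move=> hv /ascent_some [hi hw]; have := len_max (stp i * v)%g; rewrite len_stp //; lia.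
elim: f f' w => [|f IH] [|f'] w //=; rewrite ?add0n.
- by move=> h _; case E : (ascent w) => [i|] //; case: (stuck _ _ h E).
- by move=> _ h; case E : (ascent w) => [i|] //; case: (stuck _ _ h E).
- move=> h h'; case E : (ascent w) => [i|] //; have [hi hw] := ascent_some E.
  by congr ddiff; apply: IH; rewrite len_stp //; lia.
Qed.

Lemma schub_pick w : schubert w =
  if ascent w is Some i then ddiff i (schubert (stp i * w)%g) else schub_top n.
Proof.
rewrite /schubert (@schub_aux_fuel _ 'C(n, 2).+1) /=; [|lia|lia].
by case: ascent.
Qed.

Local Opaque schubert ddiff spoly.

(** The definition follows the ascent returned by [pick]; any other one gives the same result. Two
    distant ascents are compared through a common permutation two steps up, two adjacent ones
    through a common permutation three steps up, by the commutation and braid relations. The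
    induction is on the distance to maximal length. *)
Lemma schub_asc w i : (i.+1 < n)%N -> (w i < w (nexti i))%N ->
  schubert w = ddiff i (schubert (stp i * w)%g).
Proof.
have [d] := ubnP ('C(n, 2) - len w)%N; elim: d w i => // d IH w i hd hi hw.
(* The induction hypothesis one step above w, and in [IH2] two steps above w. *)
have IH' (p : 'I_n) (v : 'S_n) (q : 'I_n) : (p.+1 < n)%N -> (w p < w (nexti p))%N -> v = (stp p * w)%g ->
  (q.+1 < n)%N -> (v q < v (nexti q))%N -> schubert v = ddiff q (schubert (stp q * v)%g).
  move=> hp hwp -> hq hvq; apply: IH => //.
  by have := len_max (stp p * w)%g; rewrite len_stp //; lia.
have IH2 (p : 'I_n) (v : 'S_n) (q r : 'I_n) : (p.+1 < n)%N -> (w p < w (nexti p))%N ->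
  (q.+1 < n)%N -> ((stp p * w)%g q < (stp p * w)%g (nexti q))%N ->
  v = (stp q * (stp p * w))%g ->
  (r.+1 < n)%N -> (v r < v (nexti r))%N -> schubert v = ddiff r (schubert (stp r * v)%g).
  move=> hp hwp hq hvq -> hr hvr; apply: IH => //.
  have := len_max (stp q * (stp p * w))%g; rewrite len_stp // len_stp //.
  by have := len_max (stp p * w)%g; rewrite len_stp //; lia.
have far (p q : 'I_n) : (p.+1 < n)%N -> (q.+1 < n)%N -> (p.+1 < q)%N ->
    (w p < w (nexti p))%N -> (w q < w (nexti q))%N ->
    ddiff p (schubert (stp p * w)%g) = ddiff q (schubert (stp q * w)%g).
  move=> hp hq pq hwp hwq; have np := nextiE hp; have nq := nextiE hq.
  have fx (a b : 'I_n) : (a.+1 < n)%N -> (b != a :> nat) -> (b != a.+1 :> nat) -> stp a b = b.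
    by move=> ha h1 h2; rewrite tpermD // -val_eqE /= ?nextiE // eq_sym.
  have pq1 : ((stp p * w)%g q < (stp p * w)%g (nexti q))%N by rewrite !permM !fx //; lia.
  have qp1 : ((stp q * w)%g p < (stp q * w)%g (nexti p))%N by rewrite !permM !fx //; lia.
  have e : (stp q * (stp p * w) = stp p * (stp q * w))%g.
    by rewrite !mulgA; congr (_ * _)%g; rewrite conjgC [in X in (_ * X)%g]/stp tpermJ !fx //; lia.
  have e1 := IH' p _ q hp hwp erefl hq pq1; have e2 := IH' q _ p hq hwq erefl hp qp1.
  apply: (etrans (congr1 (ddiff p) e1)); apply/esym.
  apply: (etrans (congr1 (ddiff q) e2)); apply/esym.
  apply: (etrans (ddiff_comm _ hp hq pq)).
  exact: (congr1 (fun v => ddiff q (ddiff p (schubert v))) e).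
have near (p : 'I_n) : (p.+2 < n)%N -> (w p < w (nexti p))%N ->
    (w (nexti p) < w (nexti (nexti p)))%N ->
    ddiff p (schubert (stp p * w)%g) =
    ddiff (nexti p) (schubert (stp (nexti p) * w)%g).
  move=> hp; have hp1 : (p.+1 < n)%N by lia.
  have np := nextiE hp1; set q := nexti p in np *.
  have hq : (q.+1 < n)%N by lia.
  have nr := nextiE hq; set r := nexti q in nr * => pq qr.
  have pr' : p != r by rewrite -val_eqE /=; lia.
  have pq' : p != q by rewrite -val_eqE /=; lia.
  have qr' : q != r by rewrite -val_eqE /=; lia.
  have sp x : stp p x = tperm p q x by [].
  have sq x : stp q x = tperm q r x by [].
  have E1 : tperm p q r = r by rewrite tpermD.
  have E2 : tperm q r p = p by rewrite tpermD // eq_sym.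
  have a1 : ((stp p * w)%g q < (stp p * w)%g (nexti q))%N.
    by rewrite !permM !sp -/r tpermR E1; lia.
  have a2 : ((stp q * (stp p * w))%g p < (stp q * (stp p * w))%g (nexti p))%N.
    by rewrite -/q !permM !sp !sq tpermL E1 E2 tpermL.
  have b1 : ((stp q * w)%g p < (stp q * w)%g (nexti p))%N.
    by rewrite -/q !permM !sq tpermL E2; lia.
  have b2 : ((stp p * (stp q * w))%g q < (stp p * (stp q * w))%g (nexti q))%N.
    by rewrite -/r !permM !sp !sq tpermR E1 E2 tpermR.
  have e : (stp p * (stp q * (stp p * w)) = stp q * (stp p * (stp q * w)))%g.
    rewrite !mulgA; congr (_ * _)%g; rewrite /stp -/q -/r; transitivity (tperm p r).
      by rewrite -{1}(tpermV p q) -mulgA -conjgE tpermJ tpermR tpermD.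
    by rewrite -{1}(tpermV q r) -mulgA -conjgE tpermJ tpermL tpermD // eq_sym.
  have e1 := IH' p _ q hp1 pq erefl hq a1; have e2 := IH2 p _ q p hp1 pq hq a1 erefl hp1 a2.
  have f1 := IH' q _ p hq qr erefl hp1 b1; have f2 := IH2 q _ p q hq qr hp1 b1 erefl hq b2.
  apply: (etrans (congr1 (ddiff p) (etrans e1 (congr1 (ddiff q) e2)))); apply/esym.
  apply: (etrans (congr1 (ddiff q) (etrans f1 (congr1 (ddiff p) f2)))); apply/esym.
  apply: (etrans (ddiff_braid _ hp)).
  exact: (congr1 (fun v => ddiff q (ddiff p (ddiff q (schubert v)))) e).
rewrite schub_pick; case E : (ascent w) => [k|]; last first.
  by have := ascent_none E hi; lia.
have [hk hwk] := ascent_some E.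
case: (ltngtP k i) => [lt_ki|lt_ik|/val_inj->//].
- case: (ltngtP k.+1 i) => [h|h|h]; [exact: far|lia|].
  have ei : i = nexti k by apply: val_inj; rewrite /= nextiE.
  have hk2 : (k.+2 < n)%N by move: hi; rewrite -h.
  by have := near k hk2 hwk; rewrite -ei; apply.
- case: (ltngtP i.+1 k) => [h|h|h]; [by symmetry; apply: far|lia|].
  have ek : k = nexti i by apply: val_inj; rewrite /= nextiE.
  have hi2 : (i.+2 < n)%N by move: hk; rewrite -h.
  by symmetry; have := near i hi2 hw; rewrite -ek; apply.
Qed.

Lemma ddiff_schub_asc w i : (i.+1 < n)%N -> (w i < w (nexti i))%N ->
  ddiff i (schubert w) = 0.
Proof. by move=> hi hw; rewrite (schub_asc hi hw) ddiff_ddiff. Qed.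

Lemma ddiff_schub_desc w i : (i.+1 < n)%N -> (w (nexti i) < w i)%N ->
  ddiff i (schubert w) = schubert (stp i * w)%g.
Proof.
move=> hi hw; rewrite -{1}(stpM2 i w) -schub_asc //.
by rewrite !permM /stp tpermL tpermR.
Qed.

Lemma schub_topE : schub_top n = 'X_[[multinom (n.-1 - k)%N | k < n]].
Proof. by rewrite mpolyXE_id; apply: eq_bigr => i _; rewrite mnmE. Qed.

Lemma schub_staircase w : staircase (len w) (schubert w).
Proof.
have [d] := ubnP ('C(n, 2) - len w)%N; elim: d w => // d IH w hd.
rewrite schub_pick; case E : (ascent w) => [i|].
  have [hi hw] := ascent_some E; rewrite -[len w]/((len w).+1.-1) -(len_stp hi hw).
  apply: ddiff_staircase => //; apply: IH.
  by have := len_max (stp i * w)%g; rewrite len_stp //; lia.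
rewrite len_ascent_none // schub_topE => m; rewrite msuppX inE => /eqP->.
split; last by move=> k; rewrite mnmE.
rewrite mdegE (eq_bigr (fun i : 'I_n => n.-1 - i)%N); last by move=> i _; rewrite mnmE.
rewrite -triangular_sum -(big_mkord xpredT (fun k : nat => n.-1 - k)%N) big_nat_rev /=.
by apply: eq_big_nat => k; lia.
Qed.

(** * Monk's rule *)

(** The Bruhat covers of w: [tperm a b * w] is longer than w by exactly one. *)
Definition cov w (a b : 'I_n) :=
  [&& (a < b)%N, (w a < w b)%N &
      [forall c : 'I_n, (a < c < b)%N ==> ~~ (w a < w c < w b)%N]].

Lemma covP w a b : reflect [/\ (a < b)%N, (w a < w b)%N &
  forall c : 'I_n, ~~ [&& (a < c)%N, (c < b)%N, (w a < w c)%N & (w c < w b)%N]]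
  (cov w a b).
Proof.
apply: (iffP and3P) => -[-> -> h]; split=> //.
  by move=> c; move/forallP/(_ c): h; lia.
by apply/forallP => c; have := h c; lia.
Qed.

(** [ddiff j] kills every term of Monk's rule without a descent at j; here it leaves at most the
    term of [stp j * w]. *)
Lemma cov_asc w j a b : (j.+1 < n)%N -> (w j < w (nexti j))%N ->
  cov w a b && ((tperm a b * w)%g (nexti j) < (tperm a b * w)%g j)%N =
  (a == j) && (b == nexti j).
Proof.
move=> hj hw; have nj := nextiE hj.
apply/andP/andP => [[/covP [ab wab h]]|[/eqP -> /eqP ->]]; last first.
  split; last by rewrite !permM tpermR tpermL.
  by apply/covP; split=> //; [lia|move=> c; lia].
have h1 := h j; have h2 := h (nexti j).
have jj' : nexti j != j by rewrite eq_sym nexti_neq.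
have [W WE] : exists W : 'I_n -> nat, forall x : 'I_n, nat_of_ord (w x) = W x
  by exists (fun x => nat_of_ord (w x)).
rewrite !permM !WE => hD; rewrite !WE in hw wab h1 h2.
case: (eqVneq a j) => [ea|a1]; last case: (eqVneq a (nexti j)) => [ea|a2];
(case: (eqVneq b j) => [eb|b1]; last case: (eqVneq b (nexti j)) => [eb|b2]) => //;
try subst a; try subst b; exfalso; move: hD {h};
case: tpermP => [e1|e1|/eqP n1 /eqP n2]; case: tpermP => [e2|e2|/eqP n3 /eqP n4] hD;
nat_neq; lia.
Qed.

(** Multiplication by [stp j] matches the terms of Monk's rule for w that survive [ddiff j] with the
    covers of [stp j * w] other than w itself. *)
Lemma cov_desc w j a b : (j.+1 < n)%N -> (w (nexti j) < w j)%N ->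
  cov w a b && ((tperm a b * w)%g (nexti j) < (tperm a b * w)%g j)%N =
  cov (stp j * w)%g (stp j a) (stp j b) && ~~ ((stp j a == j) && (stp j b == nexti j)).
Proof.
move=> hj hw; have nj := nextiE hj; have wn := perm_val_neq w.
have jj' : nexti j != j by rewrite eq_sym nexti_neq.
have sj : stp j j = nexti j by rewrite /stp tpermL.
have sj' : stp j (nexti j) = j by rewrite /stp tpermR.
have sx (x : 'I_n) : x != j -> x != nexti j -> stp j x = x.
  by move=> h1 h2; rewrite /stp tpermD // eq_sym.
(* With the values of w hidden behind a function to nat, each position of a and b relative to j and
   j+1 is a problem of linear arithmetic. *)
have [W WE] : exists W : 'I_n -> nat, forall x : 'I_n, nat_of_ord (w x) = W x
  by exists (fun x => nat_of_ord (w x)).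
rewrite !permM.
have covE : cov (stp j * w)%g (stp j a) (stp j b) <->
   [/\ (stp j a < stp j b)%N, (W a < W b)%N & forall d : 'I_n, ~~ [&& (stp j a < stp j d)%N,
     (stp j d < stp j b)%N, (W a < W d)%N & (W d < W b)%N]].
  split=> [/covP|] [h1 h2 h3].
    split=> //; first by move: h2; rewrite !permM !stpK !WE.
    by move=> d; move: (h3 (stp j d)); rewrite !permM !stpK !WE.
  apply/covP; split=> //; first by rewrite !permM !stpK !WE.
  by move=> c; move: (h3 (stp j c)); rewrite !permM !stpK !WE.
have covE' : cov w a b <-> [/\ (a < b)%N, (W a < W b)%N & forall d : 'I_n,
     ~~ [&& (a < d)%N, (d < b)%N, (W a < W d)%N & (W d < W b)%N]].
  split=> [/covP|] [h1 h2 h3].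
    by split=> //; [rewrite -!WE|move=> d; rewrite -!WE].
  by apply/covP; split=> //; [rewrite !WE|move=> d; rewrite !WE].
have {}wn (x y : 'I_n) : x != y -> W x != W y by rewrite -!WE; apply: wn.
rewrite !WE in hw *.
apply/andP/andP => [[/covE' [ab wab h] hD]|[/covE [sab wab h] hN]].
  have key : [/\ (stp j a < stp j b)%N, (forall d : 'I_n, ~~ [&& (stp j a < stp j d)%N,
     (stp j d < stp j b)%N, (W a < W d)%N & (W d < W b)%N]) &
     ~~ ((stp j a == j :> nat) && (stp j b == nexti j :> nat))].
  { case: (eqVneq a j) => [ea|a1]; last case: (eqVneq a (nexti j)) => [ea|a2];
    (case: (eqVneq b j) => [eb|b1]; last case: (eqVneq b (nexti j)) => [eb|b2]);
    try subst a; try subst b;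
    move: hD;
    case: tpermP => [e1|e1|/eqP n1 /eqP n2]; case: tpermP => [e2|e2|/eqP n3 /eqP n4] hD;
    try (by exfalso; nat_neq; lia);
    rewrite ?sj ?sj' ?sx //; (split; [|move=> d; have := h d|]).
    all: try (by nat_neq; lia).
    all: case: (eqVneq d j) => [ed|d1]; last case: (eqVneq d (nexti j)) => [ed|d2];
      try subst d.
    all: rewrite ?sj ?sj' ?sx //; nat_neq; lia. }
  by case: key => k1 k2 k3; split; [apply/covE|].
have hj1 := h j; have hj2 := h (nexti j).
have key : [/\ (a < b)%N, (forall d : 'I_n, ~~ [&& (a < d)%N, (d < b)%N,
    (W a < W d)%N & (W d < W b)%N]) &
    (W (tperm a b (nexti j)) < W (tperm a b j))%N].
{ case: (eqVneq a j) => [ea|a1]; last case: (eqVneq a (nexti j)) => [ea|a2];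
  (case: (eqVneq b j) => [eb|b1]; last case: (eqVneq b (nexti j)) => [eb|b2]);
  try subst a; try subst b;
  case: tpermP => [e1|e1|/eqP n1 /eqP n2]; case: tpermP => [e2|e2|/eqP n3 /eqP n4];
  try (by exfalso; nat_neq; lia);
  rewrite ?sj ?sj' ?sx // ?eqxx // in sab hN hj1 hj2 *.
  all: split; [|move=> d; have := h d|].
  all: try (have := wn _ _ b1); try (have := wn _ _ a2).
  all: try (by nat_neq; lia).
  all: case: (eqVneq d j) => [ed|d1]; last case: (eqVneq d (nexti j)) => [ed|d2];
      try subst d.
  all: rewrite ?sj ?sj' ?sx //; nat_neq; lia. }
by case: key => k1 k2 k3; split; [apply/covE'|].
Qed.

End Schubert.


Section Monk.
Variable n : nat.
Implicit Types (i j a b : 'I_n) (u w : 'S_n).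
Local Opaque schubert ddiff.

Lemma cov_next u j : (j.+1 < n)%N -> (u j < u (nexti j))%N -> cov u j (nexti j).
Proof.
by move=> hj hu; have nj := nextiE hj; apply/covP; split=> //; [lia|move=> c; lia].
Qed.

(** Monk's rule for a single variable, the difference of the rules for two consecutive sums of
    initial variables. *)
Definition monk w i : {mpoly int[n]} :=
  \sum_(b | cov w i b) schubert (tperm i b * w)%g -
  \sum_(a | cov w a i) schubert (tperm a i * w)%g.

Lemma stp_tperm j a b w :
  (stp j * (tperm a b * w) = tperm (stp j a) (stp j b) * (stp j * w))%g.
Proof.
have sV : ((stp j)^-1 = stp j)%g by rewrite /stp tpermV.
by rewrite -tpermJ conjgE sV -!mulgA stpM2.
Qed.

Lemma ddiff_schub_tperm w j a b : (j.+1 < n)%N ->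
  ddiff j (schubert (tperm a b * w)%g) =
  if ((tperm a b * w)%g (nexti j) < (tperm a b * w)%g j)%N
  then schubert (tperm (stp j a) (stp j b) * (stp j * w))%g else 0.
Proof.
move=> hj; case: ltnP => h; first by rewrite ddiff_schub_desc // stp_tperm.
apply: ddiff_schub_asc => //; rewrite ltn_neqAle h andbT.
exact: perm_val_neq (nexti_neq hj).
Qed.

(** This and [ddiff_monk_desc] reproduce the twisted Leibniz rule [ddiffXM] for
    ['X_i * schubert w]. *)
Lemma ddiff_monk_asc w j i : (j.+1 < n)%N -> (w j < w (nexti j))%N ->
  ddiff j (monk w i) = (i == j)%:R * schubert w - (i == nexti j)%:R * schubert w.
Proof.
move=> hj hw; rewrite /monk ddiffB // !ddiff_sum //; congr (_ - _).
  rewrite (eq_bigr _ (fun b _ => ddiff_schub_tperm w i b hj)) -big_mkcondr /=.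
  rewrite (eq_bigl _ _ (fun b => cov_asc i b hj hw)).
  case: (eqVneq i j) => [->|_] /=; last by rewrite big_pred0_eq mul0r.
  by rewrite big_pred1_eq -stp_tperm stpM2 mul1r.
rewrite (eq_bigr _ (fun a _ => ddiff_schub_tperm w a i hj)) -big_mkcondr /=.
rewrite (eq_bigl _ _ (fun a => cov_asc a i hj hw)).
case: (eqVneq i (nexti j)) => [->|_] /=; last first.
  by rewrite big1 ?mul0r // => a; rewrite andbF.
rewrite (eq_bigl (fun a => a == j)); last by move=> a; rewrite andbT.
by rewrite big_pred1_eq -stp_tperm stpM2 mul1r.
Qed.

Lemma ddiff_monk_desc w j i : (j.+1 < n)%N -> (w (nexti j) < w j)%N ->
  ddiff j (monk w i) = monk (stp j * w)%g (stp j i) +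
    (i == j)%:R * schubert w - (i == nexti j)%:R * schubert w.
Proof.
move=> hj hw; rewrite /monk ddiffB // !ddiff_sum //.
have inj := can_inj (stpK j).
have eqs a b : (stp j a == b) = (a == stp j b) by rewrite -{1}(stpK j b) (inj_eq inj).
have sj : stp j j = nexti j by rewrite /stp tpermL.
have sj' : stp j (nexti j) = j by rewrite /stp tpermR.
have cj : cov (stp j * w)%g j (nexti j).
  by apply: cov_next => //; rewrite !permM /stp tpermL tpermR.
have e1 : \sum_(b | cov w i b) ddiff j (schubert (tperm i b * w)%g) =
   \sum_(b | cov (stp j * w)%g (stp j i) b) schubert (tperm (stp j i) b * (stp j * w))%g
   - (i == nexti j)%:R * schubert w.
  rewrite (eq_bigr _ (fun b _ => ddiff_schub_tperm w i b hj)) -big_mkcondr /=.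
  rewrite (eq_bigl _ _ (fun b => cov_desc i b hj hw)) /=.
  rewrite (reindex_inj inj) /=; under eq_bigr => b _ do rewrite stpK.
  under eq_bigl => b do rewrite stpK.
  (* The cover of [stp j * w] by w is the one that is not reached. It belongs to the right-hand sum
     only when i is j+1, and accounts for the correction term. *)
  rewrite eqs sj; case: (eqVneq i (nexti j)) => [->|_] /=; last first.
    by rewrite mul0r subr0; apply: eq_bigl => b; rewrite andbT.
  rewrite sj' [in RHS](bigD1 (nexti j)) //= -/(stp j).
  by rewrite stpM2 mul1r addrAC subrr add0r.
have e2 : \sum_(a | cov w a i) ddiff j (schubert (tperm a i * w)%g) =
   \sum_(a | cov (stp j * w)%g a (stp j i)) schubert (tperm a (stp j i) * (stp j * w))%g
   - (i == j)%:R * schubert w.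
  rewrite (eq_bigr _ (fun a _ => ddiff_schub_tperm w a i hj)) -big_mkcondr /=.
  rewrite (eq_bigl _ _ (fun a => cov_desc a i hj hw)) /=.
  rewrite (reindex_inj inj) /=; under eq_bigr => b _ do rewrite stpK.
  under eq_bigl => b do rewrite stpK.
  rewrite eqs sj'; case: (eqVneq i j) => [->|_] /=; last first.
    by rewrite mul0r subr0; apply: eq_bigl => b; rewrite andbF andbT.
  under eq_bigl => b do rewrite andbT.
  rewrite sj [in RHS](bigD1 j) //= -/(stp j).
  by rewrite stpM2 mul1r addrAC subrr add0r.
rewrite e1 e2; ring.
Qed.

(** By symmetry a nonzero exponent could be moved to the last variable, so only the constant term
    can survive. *)
Lemma symmetric_no_last_eq0 (f : {mpoly int[n]}) :
  (forall j, (j.+1 < n)%N -> spoly j f = f) ->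
  (forall m, m \in msupp f -> forall k : 'I_n, k.+1 = n -> m k = 0%N) ->
  f@_0%MM = 0 -> f = 0.
Proof.
move=> sym last f0; apply/mpolyP => m; rewrite mcoeff0; apply/eqP/negP => /negP.
rewrite -mcoeff_msupp => hm.
suff e : m = 0%MM by move: hm; rewrite e mcoeff_msupp f0 eqxx.
apply/mnmP => k; rewrite mnm0E.
have [d] := ubnP (n - k)%N; elim: d k m hm => // d IH k m hm hd.
case: (eqVneq k.+1 n) => [/(last _ hm)//|ne].
have hk : (k.+1 < n)%N by have := ltn_ord k; lia.
have hm' : [multinom m (stp k l) | l < n] \in msupp f.
  by rewrite mcoeff_msupp -mcoeff_sym -/(spoly k f) sym // -mcoeff_msupp.
have := IH (nexti k) _ hm'; rewrite mnmE /stp tpermR; apply.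
by rewrite nextiE //; have := ltn_ord k; lia.
Qed.

(** By induction on length every [ddiff j] kills the difference of the two sides, so it is
    symmetric; it is free of the last variable and has no constant term. The hypothesis on i passes
    to [stp j * w] and [stp j i] at a descent j, and prevents x_i from being the last variable. *)
Theorem monkP w i : (exists2 b : 'I_n, (i < b)%N & (w i < w b)%N) ->
  'X_i * schubert w = monk w i.
Proof.
have [d] := ubnP (len w); elim: d w i => // d IH w i hd [b ib wib].
apply/eqP; rewrite -subr_eq0; apply/eqP; apply: symmetric_no_last_eq0.
- move=> j hj; apply/ddiff0P => //; rewrite ddiffB // ddiffXM //.
  have := perm_val_neq w (nexti_neq hj); rewrite neq_ltn => /orP[asc|desc].
    by rewrite ddiff_schub_asc // ddiff_monk_asc //; ring.
  rewrite ddiff_schub_desc // ddiff_monk_desc // IH; first by ring.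
    have := @len_stp n j (stp j * w)%g hj; rewrite stpM2 !permM /stp tpermL tpermR.
    by move=> /(_ desc) e; lia.
  exists (stp j b); last by rewrite !permM !stpK.
  have nj := nextiE hj.
  case: (stpP j i) => [ei|ei|i1 i2]; case: (stpP j b) => [eb|eb|b1 b2];
    by rewrite ?ei ?eb in ib wib *; lia.
- have S v m (k : 'I_n) : m \in msupp (schubert v) -> k.+1 = n -> m k = 0%N.
    by move=> /schub_staircase[_ /(_ k)]; lia.
  have Ssum (P : pred 'I_n) F m (k : 'I_n) :
      m \in msupp (\sum_(c | P c) schubert (F c)) -> k.+1 = n -> m k = 0%N.
    move=> /msupp_sum_le /flatten_mapP [c _]; exact: S.
  move=> m /msuppB_le; rewrite mem_cat => /orP[|].
    move=> /msuppM_le /allpairsP [[m1 m2]] /= [+ h2 ->] k hk.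
    rewrite msuppX inE => /eqP->; rewrite mnmDE mnm1E (S _ _ _ h2 hk) addn0.
    by case: eqP => // ek; have := ltn_ord b; rewrite -ek in hk; lia.
  by move=> /msuppB_le; rewrite mem_cat => /orP[] h k hk; apply: Ssum h hk.
(* A cover has an inversion, so its Schubert polynomial has positive degree. *)
- have Z (a c : 'I_n) : cov w a c -> (schubert (tperm a c * w)%g)@_0%MM = 0.
    move=> /covP [ac wac _]; apply: memN_msupp_eq0; apply/negP => /schub_staircase[].
    rewrite mdeg0 => /esym/eqP; rewrite cards_eq0 => /eqP/setP/(_ (a, c)).
    by rewrite !inE /= !permM tpermL tpermR ac wac.
  have Zs (P : pred 'I_n) F : (forall c, P c -> (F c)@_0%MM = 0) ->
      (\sum_(c | P c) F c : {mpoly int[n]})@_0%MM = 0.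
    by move=> h; rewrite raddf_sum big1.
  rewrite mcoeffB [(monk w i)@__]mcoeffB !Zs; [|by move=> c /Z|by move=> c /Z].
  rewrite !subr0.
  apply: memN_msupp_eq0; apply/negP => /msuppM_le /allpairsP [[m1 m2]] /= [+ _].
  rewrite msuppX inE => /eqP->; move/eqP.
  by rewrite eq_sym mnmD_eq0 mnm1_eq0.
Qed.

End Monk.


(** * Ranks of finite families *)

Section Rank.
Variables (F : fieldType) (V : lmodType F).

Definition lfree (I : finType) (v : I -> V) (A : {set I}) : Prop :=
  forall c : I -> F, \sum_(i in A) c i *: v i = 0 -> forall i, i \in A -> c i = 0.

Definition spans (I : finType) (v : I -> V) (A : {set I}) (x : V) : Prop :=
  exists c : I -> F, x = \sum_(i in A) c i *: v i.

Lemma spans_sum (I : finType) (v : I -> V) (A : {set I}) (J : finType) (P : pred J)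
    (c : J -> F) (x : J -> V) :
  (forall j, P j -> spans v A (x j)) -> spans v A (\sum_(j | P j) c j *: x j).
Proof.
move=> h; apply: big_rec => [|j y Pj [d ->]].
  by exists (fun=> 0); rewrite big1 // => i _; rewrite scale0r.
have [e ->] := h _ Pj; exists (fun i => c j * e i + d i).
by rewrite scaler_sumr -big_split /=; apply: eq_bigr => i _; rewrite scalerDl scalerA.
Qed.

(** If A were larger than B, the matrix of coefficients would have more rows than columns, and a
    vector of its left kernel would be a relation among the v i. *)
Lemma steinitz (I J : finType) (u : J -> V) (B : {set J}) (v : I -> V) (A : {set I}) :
  lfree v A -> (forall i, i \in A -> spans u B (v i)) -> (#|A| <= #|B|)%N.
Proof.
move=> fA sp; rewrite leqNgt; apply/negP => lt_BA.
have [C CP] : exists C : I -> J -> F, forall i, i \in A -> v i = \sum_(j in B) C i j *: u j.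
  have h i : exists c : J -> F, i \in A -> v i = \sum_(j in B) c j *: u j.
    by case: (boolP (i \in A)) => [/sp[c e]|_]; [exists c|exists (fun=> 0)].
  exists (fun i => proj1_sig (constructive_indefinite_description _ (h i))) => i.
  by case: constructive_indefinite_description.
pose M := \matrix_(i < #|A|, j < #|B|) C (enum_val i) (enum_val j).
have : ~~ row_free M.
  by rewrite /row_free neq_ltn (leq_ltn_trans _ lt_BA) // rank_leq_col.
rewrite -kermx_eq0 => /rowV0Pn[r /sub_kermxP rM /eqP]; case.
apply/rowP => k; rewrite mxE.
have [i0 Ai0] : exists i, i \in A by exists (enum_val k); apply: enum_valP.
pose c i := if i \in A then r 0 (enum_rank_in Ai0 i) else 0.
suff h : forall i, i \in A -> c i = 0.
  by have := h _ (enum_valP k); rewrite /c enum_valP enum_valK_in.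
apply: fA; rewrite (eq_bigr (fun i => \sum_(j in B) (c i * C i j) *: u j)); last first.
  by move=> i Ai; rewrite CP // scaler_sumr; apply: eq_bigr => j _; rewrite scalerA.
rewrite exchange_big /=; apply: big1 => j Bj; rewrite -scaler_suml.
rewrite (big_enum_val (fun i => c i * C i j)) /=.
have := congr1 (fun m : 'rV_#|B| => m 0 (enum_rank_in Bj j)) rM.
rewrite !mxE => e; rewrite (_ : \sum_(i < _) _ = 0) ?scale0r // -[RHS]e.
by apply: eq_bigr => i _; rewrite !mxE /c enum_valP enum_valK_in enum_rankK_in.
Qed.

Definition decb (P : Prop) : bool := if excluded_middle_informative P then true else false.

Lemma decbP P : reflect P (decb P).
Proof. by rewrite /decb; case: excluded_middle_informative => h; constructor. Qed.

(** The dimension of the span, taken as the size of a largest independent subfamily because the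
    ambient space need not be finite dimensional. *)
Definition lrank (I : finType) (v : I -> V) (A : {set I}) : nat :=
  \max_(B : {set I} | decb (B \subset A /\ lfree v B)) #|B|.

Lemma lrank_max (I : finType) (v : I -> V) (A B : {set I}) :
  B \subset A -> lfree v B -> (#|B| <= lrank v A)%N.
Proof.
by move=> sBA fB; rewrite /lrank (bigD1 B) /= ?leq_maxl //; apply/decbP.
Qed.

Lemma lrank_basis (I : finType) (v : I -> V) (A : {set I}) : exists B : {set I},
  [/\ B \subset A, lfree v B, #|B| = lrank v A & forall i, i \in A -> spans v B (v i)].
Proof.
have [B /decbP[sBA fB] eB] : {B : {set I} | decb (B \subset A /\ lfree v B) & lrank v A = #|B|}.
  apply: eq_bigmax_cond; apply/card_gt0P; exists set0; rewrite unfold_in; apply/decbP.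
  by split; [exact: sub0set|move=> c _ i; rewrite inE].
exists B; split=> // i Ai.
case: (boolP (i \in B)) => [Bi|nBi].
  exists (fun j => (j == i)%:R); rewrite (bigD1 i) //= eqxx scale1r big1 ?addr0 //.
  by move=> j /andP[_ /negbTE->]; rewrite scale0r.
have [] := Classical_Prop.classic (lfree v (i |: B)).
  move=> /lrank_max h; have := h A; rewrite subUset sub1set Ai sBA => /(_ isT).
  by rewrite cardsU1 nBi eB ltnn.
move=> /Classical_Pred_Type.not_all_ex_not[c nc].
have [e] : \sum_(j in i |: B) c j *: v j = 0 /\ ~ (forall j, j \in i |: B -> c j = 0).
  by split; [apply: Classical_Prop.NNPP => h|move=> h]; apply: nc => // h'; case: h.
move: e; rewrite big_setU1 //= => e nz.
have ci : c i != 0.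
  apply/negP => /eqP ci; apply: nz => j; rewrite !inE => /orP[/eqP->//|Bj].
  by apply: (fB c) => //; move: e; rewrite ci scale0r add0r.
exists (fun j => - (c i)^-1 * c j).
apply: (scalerI ci); rewrite scaler_sumr.
move/eqP: e; rewrite addr_eq0 => /eqP->; rewrite -sumrN; apply: eq_bigr => j _.
by rewrite scalerA mulrA mulrN mulfV // mulN1r scaleNr.
Qed.

End Rank.


(** * Minors *)

Section Minors.
Variables (A : comNzRingType) (n : nat) (Y : 'M[A]_n).
Implicit Types (S P I : {set 'I_n}) (k c : 'I_n -> 'I_n).

(* The minor of Y on the columns k s and the rows c s, for s in S. *)
Definition minor S k c : A :=
  \sum_(p : 'S_n | perm_on S p) (-1) ^+ p * \prod_(s in S) Y (c (p s)) (k s).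

Lemma eq_minor S k k' c c' : {in S, k =1 k'} -> {in S, c =1 c'} ->
  minor S k c = minor S k' c'.
Proof.
move=> ek ec; apply: eq_bigr => p hp; congr (_ * _); apply: eq_bigr => s hs.
by rewrite ek // ec // perm_closed.
Qed.

Lemma perm_onV S (p : 'S_n) : perm_on S p -> perm_on S p^-1%g.
Proof.
move=> hp; apply/subsetP => x; rewrite inE; apply: contraR => nx.
by apply/eqP; rewrite -{1}(out_perm hp nx) permK.
Qed.

Lemma perm_on_sub S S' (p : 'S_n) : S \subset S' -> perm_on S p -> perm_on S' p.
Proof. by move=> sS /subset_trans; apply. Qed.

Lemma big_perm_on S (p : 'S_n) (f : 'I_n -> A) : perm_on S p ->
  \prod_(s in S) f s = \prod_(s in S) f (p s).
Proof.
move=> hp; rewrite (reindex_inj (@perm_inj _ p)) /=.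
by apply: eq_bigl => s; rewrite perm_closed.
Qed.

Lemma prod_setU (S S' : {set 'I_n}) (f : 'I_n -> A) : [disjoint S & S'] ->
  \prod_(s in S :|: S') f s = \prod_(s in S) f s * \prod_(s in S') f s.
Proof. by move=> h; rewrite -bigU //=; apply: eq_bigl => s; rewrite !inE. Qed.

Lemma minor_col_perm S k c (q : 'S_n) : perm_on S q ->
  minor S (fun s => k (q s)) c = (-1) ^+ q * minor S k c.
Proof.
move=> hq; rewrite /minor (reindex_inj (mulgI q)) /= mulr_sumr.
apply: eq_big => [p|p hp].
  apply/idP/idP => h; last exact: perm_onM.
  by rewrite -(mulKg q p); apply: perm_onM => //; apply: perm_onV.
rewrite odd_permM signr_addb -mulrA; congr (_ * (_ * _)).
rewrite [RHS](big_perm_on _ hq); apply: eq_bigr => s _; by rewrite permM.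
Qed.

Lemma minor_row_perm S k c (q : 'S_n) : perm_on S q ->
  minor S k (fun s => c (q s)) = (-1) ^+ q * minor S k c.
Proof.
move=> hq; rewrite /minor [in RHS](reindex_inj (mulIg q)) /= mulr_sumr.
apply: eq_big => [p|p hp].
  apply/idP/idP => h; first exact: perm_onM.
  by rewrite -(mulgK q p); apply: perm_onM => //; apply: perm_onV.
rewrite odd_permM mulrA -signr_addb addbCA addbb addbF.
by congr (_ * _); apply: eq_bigr => s _; rewrite permM.
Qed.

Lemma perm_on_tperm S (u v : 'I_n) : u \in S -> v \in S -> perm_on S (tperm u v).
Proof.
move=> uS vS; apply/subsetP => x; rewrite inE.
by case: tpermP => [->|->|]; rewrite ?eqxx.
Qed.

Lemma minor_relabel (q : 'S_n) S k c :
  minor (q @: S) k c = minor S (fun s => k (q s)) (fun s => c (q s)).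
Proof.
rewrite /minor (reindex_inj (conjg_inj q)) /=; apply: eq_big => [p|p hp].
  apply/subsetP/subsetP => h x; rewrite inE => hx.
    rewrite -(mem_imset _ _ (@perm_inj _ q)); apply: h.
    by rewrite inE permJ (inj_eq perm_inj).
  have : q^-1%g x \in S; last by move=> /(imset_f q); rewrite permKV.
  apply: h; rewrite inE; apply: contraNneq hx => e.
  by rewrite -{1}(permKV q x) permJ e permKV.
rewrite odd_permJ big_imset /=; last by move=> ? ? _ _; apply: perm_inj.
by congr (_ * _); apply: eq_bigr => s _; rewrite permJ.
Qed.

Hypothesis two_torsion_free : forall x : A, x = - x -> x = 0.

Lemma minor_col_alt S k c (u v : 'I_n) : u \in S -> v \in S -> u != v -> k u = k v ->
  minor S k c = 0.
Proof.
move=> uS vS uv kuv; apply: two_torsion_free; rewrite -mulN1r.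
have := minor_col_perm k c (perm_on_tperm uS vS).
rewrite odd_tperm uv => <-; apply: eq_minor => // s _ /=.
by case: tpermP => [->|->|].
Qed.

Lemma minor_row_alt S k c (u v : 'I_n) : u \in S -> v \in S -> u != v -> c u = c v ->
  minor S k c = 0.
Proof.
move=> uS vS uv cuv; apply: two_torsion_free; rewrite -mulN1r.
have := minor_row_perm k c (perm_on_tperm uS vS).
rewrite odd_tperm uv => <-; apply: eq_minor => // s _ /=.
by case: tpermP => [->|->|].
Qed.

Lemma perm_stab_norm S (t : 'S_n) : {in S, forall x, t x \in S} -> t \in 'N(S | 'P)%g.
Proof. by move=> h; rewrite inE in_setT inE; apply/subsetP => x xS; rewrite inE; apply: h. Qed.

Section Exchange.
Variables (P P' I : {set 'I_n}) (a : 'I_n) (c c' : 'I_n -> 'I_n).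
Hypotheses (sPP' : P \subset P') (dIP' : [disjoint I & P']) (aP' : a \notin P') (aI : a \notin I).
Let S' := a |: (P' :|: I).

Let dPI : [disjoint P & I].
Proof. by rewrite disjoint_sym; apply: disjointWr dIP'. Qed.

(* The rows c' of the columns S' are distributed in all possible ways over the
   columns P', the slots I of the columns k @: (P :|: I), and the column a'. *)
Definition exchange (a' : 'I_n) (k : 'I_n -> 'I_n) : A :=
  \sum_(p : 'S_n | perm_on S' p) (-1) ^+ p * (Y (c' (p a)) a' *
     minor P' id (fun s => c' (p s)) *
     minor (P :|: I) k (fun s => if s \in I then c' (p s) else c s)).

Let col a' k (r t : 'S_n) s :=
  if s == a then a' else if s \in P' then (r^-1)%g s else k ((t^-1)%g s).

(** Expand the two inner minors by r and t and sum over p first: the redistribution of rows becomes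
    a minor with all the columns [col] at once, so that repeated columns can be used. *)
Lemma exchangeE a' k : exchange a' k =
  \sum_(r : 'S_n | perm_on P' r) \sum_(t : 'S_n | perm_on (P :|: I) t)
    (-1) ^+ r * (-1) ^+ t * (\prod_(s in P) Y (c s) (k ((t^-1)%g s))) *
    minor S' (col a' k r t) c'.
Proof.
rewrite /exchange /minor.
under eq_bigr => p hp.
  rewrite -mulrA mulr_suml mulr_sumr mulr_sumr.
  under eq_bigr => r hr do rewrite !mulr_sumr.
  over.
rewrite exchange_big /=; apply: eq_bigr => r hr.
rewrite exchange_big /=; apply: eq_bigr => t ht.
rewrite mulr_sumr; apply: eq_bigr => p hp.
rewrite [in RHS]/S' big_setU1 /=; last by rewrite inE negb_or aP' aI.
rewrite [in RHS]prod_setU 1?disjoint_sym //.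
have -> : col a' k r t a = a' by rewrite /col eqxx.
have -> : \prod_(s in P') Y (c' (p s)) (col a' k r t s) =
          \prod_(s in P') Y (c' (p (r s))) s.
  rewrite (big_perm_on _ hr); apply: eq_bigr => s sP.
  have rs : r s \in P' by rewrite perm_closed.
  by rewrite /col rs permK; case: eqP => // e; rewrite e (negbTE aP') in rs.
have -> : \prod_(s in P :|: I) Y (if t s \in I then c' (p (t s)) else c (t s)) (k s) =
   (\prod_(s in P) Y (c s) (k ((t^-1)%g s))) * \prod_(s in I) Y (c' (p s)) (col a' k r t s).
  transitivity (\prod_(s in P :|: I) Y (if s \in I then c' (p s) else c s) (k ((t^-1)%g s))).
    by rewrite [RHS](big_perm_on _ ht); apply: eq_bigr => s _; rewrite permK.
  rewrite prod_setU //; congr (_ * _); apply: eq_bigr => s hs.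
    by rewrite (disjointFr dPI hs).
  by rewrite hs /col (disjointFr dIP' hs); case: eqP => // e; rewrite e (negbTE aI) in hs.
have R (e1 e2 e3 y x1 x2 x3 : A) :
  e1 * (y * (e2 * x1 * (e3 * (x2 * x3)))) = e2 * e3 * x2 * (e1 * (y * (x1 * x3))) by ring.
exact: R.
Qed.

Lemma perm_stab S (t : 'S_n) : {in S, forall s, (t^-1)%g s \in S} ->
  {in S, forall s, t s \in S}.
Proof.
move=> h s sS; have e : (t^-1)%g @: S = S.
  apply/eqP; rewrite eqEcard card_imset ?leqnn ?andbT; last exact: perm_inj.
  by apply/subsetP => _ /imsetP[x xS ->]; apply: h.
by move: sS; rewrite -{1}e => /imsetP[x xS ->]; rewrite permKV.
Qed.

(** If t does not preserve I, some slot of I receives a column of P. As P lies in P', that column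
    also occurs in a slot of P'. *)
Let colP a' k (r t : 'S_n) : {in P, k =1 id} -> perm_on P' r -> perm_on (P :|: I) t ->
  {in I, forall s, (t^-1)%g s \in I} \/ minor S' (col a' k r t) c' = 0.
Proof.
move=> kP hr ht; case: (boolP [forall s in I, (t^-1)%g s \in I]).
  by move=> /forall_inP; left.
rewrite negb_forall_in => /exists_inP [s sI tsI]; right.
have tsP : (t^-1)%g s \in P.
  have : (t^-1)%g s \in P :|: I by rewrite perm_closed ?inE ?sI ?orbT //; apply: perm_onV.
  by rewrite inE (negbTE tsI) orbF.
have rsP' : r ((t^-1)%g s) \in P' by rewrite perm_closed //; apply: (subsetP sPP').
have na x : x \in P' :|: I -> (x == a) = false.
  by move=> h; apply/eqP => e; move: h; rewrite e inE (negbTE aP') (negbTE aI).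
apply: (@minor_col_alt _ _ _ s (r ((t^-1)%g s))).
- by rewrite !inE sI !orbT.
- by rewrite !inE rsP' orbT.
- by apply: contraTneq rsP' => <-; rewrite (disjointFr dIP' sI).
- rewrite /col !na ?inE ?sI ?rsP' ?orbT // (disjointFr dIP' sI) permK kP //.
Qed.

(** Column a' stands in slot a and a second time in P' or in I, unless [colP] already gives zero. *)
Lemma exchange_eq0 a' k : {in P, k =1 id} ->
  (a' \in P' \/ exists2 s, s \in I & k s = a') -> exchange a' k = 0.
Proof.
move=> kP h; rewrite exchangeE; apply: big1 => r hr; apply: big1 => t ht.
suff -> : minor S' (col a' k r t) c' = 0 by rewrite mulr0.
have na x : x \in P' :|: I -> (x == a) = false.
  by move=> h'; apply/eqP => e; move: h'; rewrite e inE (negbTE aP') (negbTE aI).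
case: h => [a'P'|[s sI ks]].
  have raP' : r a' \in P' by rewrite perm_closed.
  apply: (@minor_col_alt _ _ _ a (r a')).
  - by rewrite !inE eqxx.
  - by rewrite !inE raP' orbT.
  - by rewrite eq_sym na // inE raP'.
  - by rewrite /col eqxx na ?raP' ?permK // inE raP'.
case: (colP a' kP hr ht) => // tI; have tsI := perm_stab tI sI.
apply: (@minor_col_alt _ _ _ a (t s)).
- by rewrite !inE eqxx.
- by rewrite !inE tsI !orbT.
- by rewrite eq_sym na // inE tsI orbT.
- by rewrite /col eqxx na ?inE ?tsI ?orbT // (disjointFr dIP' tsI) permK.
Qed.

(** The surviving t are products of a permutation q of P and a permutation s of I. The q assemble
    the minor on P; r and s only contribute signs that cancel, so they are merely counted. *)
Lemma exchange_id : exchange a id =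
  (#|[set r : 'S_n | perm_on P' r]| * #|[set t : 'S_n | perm_on I t]|)%:R *
  (minor P id c * minor S' id c').
Proof.
pose stab (t : 'S_n) := perm_on (P :|: I) t && [forall s in I, (t^-1)%g s \in I].
have kP : {in P, id =1 id} by [].
rewrite exchangeE.
transitivity (\sum_(r : 'S_n | perm_on P' r) \sum_(t : 'S_n | stab t)
    (-1) ^+ r * (-1) ^+ t * (\prod_(s in P) Y (c s) ((t^-1)%g s)) *
    minor S' (col a id r t) c').
  apply: eq_bigr => r hr; rewrite /stab big_mkcondr /=; apply: eq_bigr => t ht.
  case: ifPn => // /forall_inP h; case: (colP a kP hr ht) => [//|->]; by rewrite mulr0.
have onPI (q s : 'S_n) : perm_on P q -> perm_on I s ->
    [/\ {in I, (q * s)%g =1 s}, {in P, ((q * s)^-1)%g =1 (q^-1)%g} &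
        {in I, ((q * s)^-1)%g =1 (s^-1)%g}].
  move=> hq hs; split=> x xS.
  - by rewrite permM (out_perm hq) // (disjointFl dPI xS).
  - by rewrite invMg permM (out_perm (perm_onV hs)) // (disjointFr dPI xS).
  - rewrite invMg permM (out_perm (perm_onV hq)) // (disjointFl dPI) //.
    by rewrite perm_closed //; apply: perm_onV.
transitivity (\sum_(r : 'S_n | perm_on P' r)
    \sum_(qs : 'S_n * 'S_n | perm_on P qs.1 && perm_on I qs.2)
    ((-1) ^+ qs.1 * \prod_(s in P) Y (c s) ((qs.1^-1)%g s)) * minor S' id c').
  apply: eq_bigr => r hr.
  (* A stabilizing t is recovered from its restrictions to the disjoint sets P and I. *)
  rewrite (reindex_onto (fun qs : 'S_n * 'S_n => qs.1 * qs.2)%g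
     (fun t => (restr_perm P t, restr_perm I t))) /=; last first.
    move=> t /andP[ht /forall_inP tI].
    have tI' := perm_stab tI.
    have tP : {in P, forall s, t s \in P}.
      move=> s sP; have : t s \in P :|: I by rewrite perm_closed // inE sP.
      rewrite inE => /orP[//|/tI]; rewrite permK => sI.
      by rewrite (disjointFr dPI sP) in sI.
    apply/permP => x; rewrite permM.
    case: (boolP (x \in P)) => [xP|xP].
      have -> : restr_perm P t x = t x by rewrite restr_permE ?perm_stab_norm.
      by rewrite (out_perm (restr_perm_on I t)) // (disjointFr dPI) // tP.
    rewrite (out_perm (restr_perm_on P t)) //.
    case: (boolP (x \in I)) => [xI|xI]; first by rewrite restr_permE ?perm_stab_norm.
    rewrite (out_perm (restr_perm_on I t)) // (out_perm ht) // inE negb_or xP //.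
  apply: eq_big => [[q s] /=|[q s] /= /andP[/andP[hst _] /eqP[eq es]]].
    apply/idP/idP => [/andP[_ /eqP[<- <-]]|/andP[hq hs]]; first by rewrite !restr_perm_on.
    have [qsI qsP' qsI'] := onPI _ _ hq hs.
    have qsP : {in P, (q * s)%g =1 q}.
      move=> x xP; rewrite permM (out_perm hs) // (disjointFr dPI) // perm_closed //.
    apply/andP; split.
      rewrite /stab perm_onM ?(perm_on_sub _ hq) ?(perm_on_sub _ hs) ?subsetUl ?subsetUr //=.
      by apply/forall_inP => x xI; rewrite qsI' // perm_closed //; apply: perm_onV.
    rewrite xpair_eqE; apply/andP; split; apply/eqP/permP => x.
      case: (boolP (x \in P)) => xP; last by rewrite (out_perm (restr_perm_on _ _) xP) (out_perm hq xP).
      by rewrite restr_permE ?qsP // perm_stab_norm // => y yP; rewrite qsP // perm_closed.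
    case: (boolP (x \in I)) => xI; last by rewrite (out_perm (restr_perm_on _ _) xI) (out_perm hs xI).
    by rewrite restr_permE ?qsI // perm_stab_norm // => y yI; rewrite qsI // perm_closed.
  have hq : perm_on P q by rewrite -eq restr_perm_on.
  have hs : perm_on I s by rewrite -es restr_perm_on.
  have [_ qsP' qsI'] := onPI _ _ hq hs.
  have hrV := perm_onV hr; have hsV := perm_onV hs.
  have -> : \prod_(x in P) Y (c x) (((q * s)^-1)%g x) = \prod_(x in P) Y (c x) ((q^-1)%g x).
    by apply: eq_bigr => x xP; rewrite qsP'.
  have -> : minor S' (col a id r (q * s)%g) c' = (-1) ^+ r * (-1) ^+ s * minor S' id c'.
    rewrite -signr_addb -odd_permV -[odd_perm s]odd_permV -odd_permM -minor_col_perm; last first.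
      apply: perm_onM; [apply: perm_on_sub hrV|apply: perm_on_sub hsV];
      by apply/subsetP => x xS; rewrite !inE xS ?orbT.
    apply: eq_minor => // x; rewrite !inE /col permM; case: eqP => [-> _|_ /=].
      by rewrite (out_perm hrV) // (out_perm hsV).
    case: (boolP (x \in P')) => [xP' _|xP' /= xI].
      rewrite (out_perm hsV) // (disjointFl dIP') //.
      by rewrite perm_closed.
    by rewrite qsI' // (out_perm hrV).
  rewrite odd_permM signr_addb.
  have R (e1 e2 e3 x m : A) : e1 * e1 = 1 -> e3 * e3 = 1 ->
      e1 * (e2 * e3) * x * (e1 * e3 * m) = e2 * x * m.
    move=> h1 h3; transitivity ((e1 * e1) * (e3 * e3) * (e2 * x * m)); first by ring.
    by rewrite h1 h3 !mul1r.
  by apply: R; rewrite -signr_addb addbb.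
rewrite (eq_bigl (fun r => r \in [set r : 'S_n | perm_on P' r])); last by move=> r; rewrite inE.
rewrite sumr_const natrM -mulrA mulr_natl; congr (_ *+ _).
rewrite -(pair_big (fun q => perm_on P q) (fun s => perm_on I s) (fun (q s : 'S_n) =>
  (-1) ^+ q * (\prod_(s in P) Y (c s) ((q^-1)%g s)) * minor S' id c')) /=.
have -> : minor P id c =
    \sum_(q : 'S_n | perm_on P q) (-1) ^+ q * \prod_(s in P) Y (c s) ((q^-1)%g s).
  apply: eq_bigr => q hq; congr (_ * _); rewrite [RHS](big_perm_on _ hq).
  by apply: eq_bigr => s _; rewrite permK.
rewrite mulr_suml mulr_sumr; apply: eq_bigr => q hq.
rewrite (eq_bigl (fun s => s \in [set s : 'S_n | perm_on I s])); last by move=> s; rewrite inE.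
by rewrite sumr_const mulr_natl.
Qed.

End Exchange.
End Minors.


(** * Column operations and their top coefficients *)

Lemma rmorph_minor (A B : comNzRingType) (f : {rmorphism A -> B}) n (Y : 'M[A]_n) S k c :
  f (minor Y S k c) = minor (map_mx f Y) S k c.
Proof.
rewrite rmorph_sum; apply: eq_bigr => p _; rewrite rmorphM rmorph_sign rmorph_prod.
by congr (_ * _); apply: eq_bigr => s _; rewrite mxE.
Qed.

Lemma coef_mul_top (A : nzRingType) (p q : {poly A}) d e : (size p <= d.+1)%N ->
  (size q <= e.+1)%N -> (p * q)`_(d + e) = p`_d * q`_e.
Proof.
move=> hp hq; have hd : (d < (d + e).+1)%N by rewrite ltnS leq_addr.
rewrite coefM (bigD1 (Ordinal hd)) //= addKn big1 ?addr0 //.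
move=> i; rewrite -val_eqE /= => ne.
case: (ltnP d i) => hi; first by rewrite [p`_i]nth_default ?mul0r // (leq_trans hp).
rewrite [q`_(_ - _)]nth_default ?mulr0 // (leq_trans hq) //.
by have := ltn_ord i; move: ne hi => /=; lia.
Qed.

(** Stated with degree bounds instead of leading coefficients, so that the coefficients concerned
    may vanish. *)
Lemma coef_prod_top (A : comNzRingType) (I : finType) (p : I -> {poly A}) (d : I -> nat) :
  (forall i, size (p i) <= (d i).+1)%N -> (\prod_i p i)`_(\sum_i d i)%N = \prod_i (p i)`_(d i).
Proof.
move=> h.
suff [] : (size (\prod_i p i)%R <= (\sum_i d i).+1)%N /\
   (\prod_i p i)`_(\sum_i d i)%N = \prod_i (p i)`_(d i) by [].
elim/big_rec3: _ => [|i x y z _ [hs <-]].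
  by rewrite size_poly1 coef1.
split; last by rewrite coef_mul_top.
apply: leq_trans (size_polyMleq _ _) _; have := h i; lia.
Qed.

Section Shift.
Variables (A : comNzRingType) (n : nat) (Y : 'M[A]_n).
Hypothesis two_torsion_free : forall x : A, x = - x -> x = 0.
Implicit Types (S : {set 'I_n}) (c : 'I_n -> 'I_n).

Definition shift (a b : 'I_n) : 'M[{poly A}]_n :=
  \matrix_(i, j) ((Y i j)%:P + if j == b then 'X * (Y i a)%:P else 0).

Definition repl (a b s : 'I_n) := if s == b then a else s.

Definition moves (a b : 'I_n) S := (b \in S) && (a \notin S).

(** Linearity in column b. If a also lies in S, the extra term has column a twice. *)
Lemma minor_shift (a b : 'I_n) S c : a != b ->
  minor (shift a b) S id c = (minor Y S id c)%:P +
    if moves a b S then 'X * (minor Y S (repl a b) c)%:P else 0.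
Proof.
move=> ab.
have C k : (minor Y S k c)%:P = \sum_(p : 'S_n | perm_on S p)
    (-1) ^+ p * \prod_(s in S) (Y (c (p s)) (k s))%:P.
  rewrite (rmorph_minor polyC); apply: eq_bigr => p _; congr (_ * _).
  by apply: eq_bigr => s _; rewrite mxE.
case: (boolP (b \in S)) => bS; last first.
  rewrite /moves (negbTE bS) addr0 C; apply: eq_bigr => p _; congr (_ * _).
  apply: eq_bigr => s sS; rewrite !mxE; case: eqP => [e|_]; last by rewrite addr0.
  by rewrite -e sS in bS.
have -> : (if moves a b S then 'X * (minor Y S (repl a b) c)%:P else 0) =
    'X * (minor Y S (repl a b) c)%:P.
  rewrite /moves bS /=; case: (boolP (a \in S)) => //= aS.
  rewrite (@minor_col_alt _ _ _ two_torsion_free S _ c a b) ?mulr0 //.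
  by rewrite /repl eqxx (negbTE ab).
rewrite (C id) (C (repl a b)) mulr_sumr -big_split /=; apply: eq_bigr => p _.
rewrite mulrCA -mulrDr; congr (_ * _).
pose Q := \prod_(s in S | s != b) (Y (c (p s)) s)%:P.
have -> : \prod_(s in S) shift a b (c (p s)) s =
    ((Y (c (p b)) b)%:P + 'X * (Y (c (p b)) a)%:P) * Q.
  rewrite (bigD1 b) //= mxE eqxx; congr (_ * _); apply: eq_bigr => s /andP[_ /negbTE sb].
  by rewrite mxE sb addr0.
have -> : \prod_(s in S) (Y (c (p s)) s)%:P = (Y (c (p b)) b)%:P * Q by rewrite (bigD1 b).
have -> : \prod_(s in S) (Y (c (p s)) (repl a b s))%:P = (Y (c (p b)) a)%:P * Q.
  rewrite (bigD1 b) //= {1}/repl eqxx; congr (_ * _); apply: eq_bigr => s /andP[_ /negbTE sb].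
  by rewrite /repl sb.
by rewrite mulrDl mulrA.
Qed.

Lemma size_minor_shift (a b : 'I_n) S c : a != b ->
  (size (minor (shift a b) S id c) <= (moves a b S).+1)%N.
Proof.
move=> ab; rewrite minor_shift //; case: moves; last first.
  by rewrite addr0 size_polyC_leq1.
rewrite (leq_trans (size_polyD _ _)) // geq_max (leq_trans (size_polyC_leq1 _)) //=.
apply: leq_trans (size_polyMleq _ _) _; rewrite size_polyX.
by have := size_polyC_leq1 (minor Y S (repl a b) c); case: (size _) => [|[]].
Qed.

Lemma coef_minor_shift (a b : 'I_n) S c : a != b ->
  (minor (shift a b) S id c)`_(moves a b S) =
  minor Y S (if moves a b S then repl a b else id) c.
Proof.
move=> ab; rewrite minor_shift //; case: moves; last by rewrite addr0 coefC.
by rewrite coefD coefXM coefC /= add0r coefC.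
Qed.

End Shift.

(** * The generic upper triangular matrix *)

Section Generic.
Variable n : nat.

Definition coordring := {mpoly rat[n * n]}.

Definition gen : 'M[coordring]_n :=
  \matrix_(i, j) if (i <= j)%N then 'X_(mxvec_index i j) else 0.

Section Subst.
Variables (S : comNzRingType) (h : {rmorphism rat -> S}) (H : 'M[S]_n).

Definition ysubst : coordring -> S := mmap h (fun k => mxvec H 0 k).

HB.instance Definition _ := GRing.RMorphism.on ysubst.

Lemma ysubst_scale x p : ysubst (x *: p) = h x * ysubst p.
Proof. exact: mmapZ. Qed.

Lemma ysubst_gen : (forall i j : 'I_n, (j < i)%N -> H i j = 0) -> map_mx ysubst gen = H.
Proof.
move=> tri; apply/matrixP => i j; rewrite !mxE; case: leqP => hij.
  by rewrite /ysubst mmapX mmap1U mxvecE.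
by rewrite rmorph0 tri.
Qed.

End Subst.

Lemma gen_diag i : gen i i != 0.
Proof. by rewrite mxE leqnn -msupp_eq0 msuppX. Qed.

Lemma gen_low (i j : 'I_n) : (j < i)%N -> gen i j = 0.
Proof. by rewrite mxE ltnNge => /negbTE->. Qed.

(** A permutation other than the identity has some [s < p s], and the factor of column s lies below
    the diagonal. *)
Lemma minor_gen_diag (S : {set 'I_n}) : minor gen S id id = \prod_(s in S) gen s s.
Proof.
rewrite /minor (bigD1 1%g) ?perm_on1 //= odd_perm1 mul1r.
under eq_bigr => s _ do rewrite perm1.
rewrite -[RHS]addr0; congr (_ + _); apply: big1 => p /andP[hp p1].
have [s sS ps] : exists2 s, s \in S & (s < p s)%N.
  apply: Classical_Prop.NNPP => h; case/eqP: p1.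
  have le s : (p s <= s)%N.
    rewrite leqNgt; apply/negP => lt; apply: h; exists s => //.
    by apply: contraTT lt => /(out_perm hp) ->; rewrite ltnn.
  apply/permP => s; rewrite perm1; apply: val_inj => /=.
  have [m] := ubnP s; elim: m s => // m IH s hs.
  have := le s; rewrite leq_eqVlt => /orP[/eqP//|lt].
  have := IH (p s) (leq_trans lt hs) => /val_inj/perm_inj e.
  by rewrite e ltnn in lt.
by rewrite (bigD1 s) //= gen_low // mul0r mulr0.
Qed.

Lemma shift_low (a b : 'I_n) : (a < b)%N ->
  forall i j : 'I_n, (j < i)%N -> shift gen a b i j = 0.
Proof.
move=> ab i j ji; rewrite mxE gen_low // add0r; case: eqP => // e.
by rewrite gen_low ?mulr0 //; rewrite e in ji; apply: ltn_trans ji.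
Qed.

Definition hshift : {rmorphism rat -> {poly coordring}} :=
  (polyC \o @mpolyC (n * n) rat : {rmorphism rat -> {poly coordring}}).

(** The column operation as a ring morphism, applicable to linear relations between products of
    minors. *)
Definition phi (a b : 'I_n) : coordring -> {poly coordring} := ysubst hshift (shift gen a b).

HB.instance Definition _ a b := GRing.RMorphism.on (phi a b).

End Generic.


(** * Flagged Weyl modules *)

Section Diagram.
Variable n : nat.
Implicit Types (w : 'S_n) (a b c j : 'I_n).

Definition rcol w (j : 'I_n) : {set 'I_n} := [set i | (i, j) \in rothe w].

Lemma in_rcol w (i c : 'I_n) : (i \in rcol w (w c)) = (i < c)%N && (w c < w i)%N.
Proof. by rewrite !inE /= permK. Qed.

(* A filling assigns a row to each box, listed as column, then row of the diagram;
   only its values on the diagram matter. *)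
Definition filling := {ffun 'I_n -> {ffun 'I_n -> 'I_n}}.

Definition weight w (T : filling) : 'X_{1..n} :=
  (\sum_j \sum_(s in rcol w j) U_(T j s))%MM.

(** A bound for the degree in ['X] of every [Delta w T] after the column operation; the coefficient
    at this degree is the one that is extracted. *)
Definition nmoves w a b : nat := \sum_j moves a b (rcol w j).

Definition Delta (A : comNzRingType) (Y : 'M[A]_n) w (T : filling) : A :=
  \prod_j minor Y (rcol w j) id (T j).

End Diagram.

(** * Lifts of generators along Bruhat covers *)

Section Lifts.
Variables (A : comNzRingType) (n : nat) (Y : 'M[A]_n).
Variable ph : 'I_n -> 'I_n -> {rmorphism A -> {poly A}}.
Hypothesis two_torsion_free : forall x : A, x = - x -> x = 0.
Hypothesis phY : forall a b : 'I_n, (a < b)%N -> map_mx (ph a b) Y = shift Y a b.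
Variable w : 'S_n.
Implicit Types (a b c j : 'I_n) (T : filling n).

Lemma ph_Delta a b T : (a < b)%N -> (ph a b (Delta Y w T))`_(nmoves w a b) =
  \prod_j minor Y (rcol w j) (if moves a b (rcol w j) then repl a b else id) (T j).
Proof.
move=> ab; have ab' : a != b by rewrite -val_eqE /= neq_ltn ab.
rewrite rmorph_prod /= coef_prod_top => [|j].
  by apply: eq_bigr => j _; rewrite rmorph_minor /= phY // coef_minor_shift.
by rewrite rmorph_minor /= phY // size_minor_shift.
Qed.

(** For a cover this and [between] split column [w b] of the diagram at row a. Passing to
    [tperm a b * w] moves the boxes of [between] to column [w a], which also gains a box in row a:
    the shape treated by [exchange]. *)
Definition above a b : {set 'I_n} := [set i : 'I_n | (i < a)%N && (w b < w i)%N].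

Definition between a b : {set 'I_n} := [set i : 'I_n | [&& (a < i)%N, (i < b)%N & (w b < w i)%N]].

Lemma coef_sign (B : nzRingType) (e : bool) (q : {poly B}) m :
  ((-1) ^+ e * q)`_m = (-1) ^+ e * q`_m.
Proof. by rewrite !mulr_sign; case: e; rewrite ?coefN. Qed.

Definition functional (a b : 'I_n) (h : {ffun 'I_n -> A}) : A :=
  \sum_c Y c a * (ph a b (h c))`_(nmoves w a b).

Section Cover.
Variables a b : 'I_n.
Hypothesis cab : cov w a b.
Let v := (tperm a b * w)%g.
Let P := above a b.
Let P' := rcol w (w a).
Let I := between a b.

Let ab : (a < b)%N. Proof. by case/covP: cab. Qed.
Let wab : (w a < w b)%N. Proof. by case/covP: cab. Qed.
Let hc c : ~~ [&& (a < c)%N, (c < b)%N, (w a < w c)%N & (w c < w b)%N].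
Proof. by case/covP: cab. Qed.

Let va : v a = w b. Proof. by rewrite permM tpermL. Qed.
Let vb : v b = w a. Proof. by rewrite permM tpermR. Qed.

Lemma cover_aboveE : rcol v (w b) = P.
Proof.
apply/setP => i; rewrite -va in_rcol inE va permM.
by case: tpermP => [->|->|//]; rewrite ?ltnn //; lia.
Qed.

Lemma cover_rcol_b : rcol w (w b) = P :|: I.
Proof.
apply/setP => i; rewrite in_rcol !inE.
case: (eqVneq i a) => [->|ia]; first by rewrite !ltnn; lia.
by have := ord_val_neq ia; lia.
Qed.

Lemma cover_rcol_a : rcol v (w a) = a |: (P' :|: I).
Proof.
apply/setP => i; rewrite -vb in_rcol !inE /= -[(w^-1)%g (w a)]/((w^-1)%g (w a)) permK vb permM.
have := hc i; case: tpermP => [->|->|/eqP ia /eqP ib].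
- by rewrite eqxx; lia.
- by rewrite !ltnn -val_eqE /=; lia.
- have na := ord_val_neq ia; have nb := ord_val_neq ib.
  have wa := perm_val_neq w ia; have wb := perm_val_neq w ib.
  by rewrite (negbTE ia); lia.
Qed.

Lemma cover_sub : P \subset P'.
Proof. by apply/subsetP => i; rewrite in_rcol inE; lia. Qed.

Lemma cover_disjoint : [disjoint I & P'].
Proof.
apply/pred0P => i /=; apply/negP => /andP[]; rewrite in_rcol inE; lia.
Qed.

Lemma cover_a_P' : a \notin P'. Proof. by rewrite in_rcol ltnn. Qed.
Lemma cover_a_I : a \notin I. Proof. by rewrite inE ltnn. Qed.

(** Only a column w c with a < c < b and w a < w c < w b would gain a box, and the cover condition
    excludes it. *)
Lemma cover_rcol_other j : j != w a -> j != w b ->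
  rcol v j = if moves a b (rcol w j) then tperm a b @: rcol w j else rcol w j.
Proof.
move=> ja jb; pose c := (w^-1)%g j; have ej : j = w c by rewrite permKV.
have ca : c != a by apply: contraNneq ja => e; rewrite ej e.
have cb : c != b by apply: contraNneq jb => e; rewrite ej e.
have vc : v c = w c by rewrite permM tpermD // eq_sym.
have na := ord_val_neq ca; have nb := ord_val_neq cb.
have wa := perm_val_neq w ca; have wb := perm_val_neq w cb.
have h := hc c.
apply/setP => i; rewrite ej -{1}vc in_rcol vc permM.
rewrite /moves !in_rcol.
case: ifP => [hm|hm]; last first.
  rewrite in_rcol; case: tpermP => [->|->|//]; lia.
have -> : (i \in tperm a b @: rcol w (w c)) = (tperm a b i \in rcol w (w c)).
  by rewrite -{1}(tpermK a b i) mem_imset //; apply: perm_inj.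
rewrite in_rcol; case: tpermP => [->|->|//]; lia.
Qed.

Definition relift T (p : 'S_n) : filling n := [ffun j : 'I_n =>
  if j == w a then [ffun s => T (w a) (p s)]
  else if j == w b then [ffun s => if s \in I then T (w a) (p s) else T (w b) s]
  else if moves a b (rcol w j) then [ffun s => T j (tperm a b s)] else T j].

(* Up to a factor, [functional a b] maps this lift to [Delta Y v T]: the rows of the column
   w a of v are redistributed over the columns w a and w b of w and the extra index c. *)
Definition cover_lift T : {ffun 'I_n -> A} := [ffun c =>
  \sum_(p : 'S_n | perm_on (rcol v (w a)) p && (T (w a) (p a) == c)) (-1) ^+ p *
    Delta Y w (relift T p)].

(** Column [w a] of v has one more slot than can be refilled. The row sent to slot a is left over
    and becomes the index c, hence the variable x_c in Monk's rule. *)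
Lemma weight_relift T (p : 'S_n) : perm_on (rcol v (w a)) p ->
  (weight w (relift T p) + U_(T (w a) (p a)))%MM = weight v T.
Proof.
move=> hp; have wab' : w b != w a by rewrite -val_eqE /= neq_ltn wab orbT.
have wba' : w a != w b by rewrite eq_sym.
have sumU (S1 S2 : {set 'I_n}) (f : 'I_n -> 'X_{1..n}) : [disjoint S1 & S2] ->
    (\sum_(s in S1 :|: S2) f s = \sum_(s in S1) f s + \sum_(s in S2) f s)%MM.
  by move=> h; rewrite -bigU //=; apply: eq_bigl => s; rewrite !inE.
have D (f : 'I_n -> 'X_{1..n}) : (\sum_j f j =
    f (w a) + (f (w b) + \sum_(j | (j != w a) && (j != w b)) f j))%MM.
  by rewrite (bigD1 (w a)) //= (bigD1 (w b)).
rewrite /weight [X in (X + _)%MM = _]D [RHS]D.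
have -> : (\sum_(j | (j != w a) && (j != w b)) \sum_(s in rcol w j) U_(relift T p j s) =
    \sum_(j | (j != w a) && (j != w b)) \sum_(s in rcol v j) U_(T j s))%MM.
  apply: eq_bigr => j /andP[ja jb]; rewrite cover_rcol_other // ffunE (negbTE ja) (negbTE jb).
  case: ifP => // _; rewrite [RHS]big_imset /=; last by move=> ? ? _ _; apply: perm_inj.
  by apply: eq_bigr => s _; rewrite ffunE.
have -> : (\sum_(s in rcol v (w a)) U_(T (w a) s) =
   U_(T (w a) (p a)) + \sum_(s in P') U_(T (w a) (p s)) + \sum_(s in I) U_(T (w a) (p s)))%MM.
  have -> : (\sum_(s in rcol v (w a)) U_(T (w a) s) = \sum_(s in rcol v (w a)) U_(T (w a) (p s)))%MM.
    rewrite (reindex_inj (@perm_inj _ p)) /=; apply: eq_bigl => s; by rewrite perm_closed.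
  rewrite cover_rcol_a big_setU1 /=; last by rewrite inE negb_or cover_a_P' cover_a_I.
  by rewrite sumU 1?disjoint_sym ?cover_disjoint // addmA.
have -> : (\sum_(s in rcol w (w b)) U_(relift T p (w b) s) =
   \sum_(s in P) U_(T (w b) s) + \sum_(s in I) U_(T (w a) (p s)))%MM.
  have dPI : [disjoint P & I].
    by rewrite disjoint_sym; apply: disjointWr cover_disjoint; exact: cover_sub.
  rewrite cover_rcol_b sumU //; congr (_ + _)%MM; apply: eq_bigr => s sS;
    rewrite ffunE (negbTE wab') eqxx ffunE ?sS // (disjointFr dPI) //.
rewrite cover_aboveE -/P'.
have -> : (\sum_(s in P') U_(relift T p (w a) s) = \sum_(s in P') U_(T (w a) (p s)))%MM.
  by apply: eq_bigr => s _; rewrite ffunE eqxx ffunE.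
apply/mnmP => k; rewrite !mnmDE; lia.
Qed.

Lemma prod_cover_split (f : 'I_n -> A) :
  \prod_j f j = (\prod_(j | (j != w a) && (j != w b)) f j) * (f (w a) * f (w b)).
Proof.
have wab' : w b != w a by rewrite -val_eqE /= neq_ltn wab orbT.
by rewrite (bigD1 (w a)) //= (bigD1 (w b)) //= mulrA mulrC.
Qed.

(** Summing over c removes the constraint on p in [cover_lift]. Columns other than [w a] and [w b]
    do not depend on p; column [w a] is not moved, since all its rows are above a and hence above
    b'. *)
Lemma functional_lift T (a' b' : 'I_n) : (a' < b')%N -> (a < b')%N ->
  let kap j := if moves a' b' (rcol w j) then repl a' b' else id in
  functional a' b' (cover_lift T) =
  (\prod_(j | (j != w a) && (j != w b)) minor Y (rcol w j) (kap j) (relift T 1 j)) *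
  exchange Y P P' I a (T (w b)) (T (w a)) a' (kap (w b)).
Proof.
move=> ab' ab'' kap.
have wab' : w b != w a by rewrite -val_eqE /= neq_ltn wab orbT.
pose DK p := \prod_j minor Y (rcol w j) (kap j) (relift T p j).
have e1 c : (ph a' b' (cover_lift T c))`_(nmoves w a' b') =
   \sum_(p : 'S_n | perm_on (rcol v (w a)) p && (T (w a) (p a) == c)) (-1) ^+ p * DK p.
  rewrite ffunE rmorph_sum coef_sum; apply: eq_bigr => p _.
  by rewrite rmorphM rmorph_sign coef_sign ph_Delta.
transitivity (\sum_c \sum_(p : 'S_n | perm_on (rcol v (w a)) p && (T (w a) (p a) == c))
   Y (T (w a) (p a)) a' * ((-1) ^+ p * DK p)).
  apply: eq_bigr => c _; rewrite -[X in _ * X]/((ph a' b' (cover_lift T c))`_(nmoves w a' b')) e1.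
  by rewrite mulr_sumr; apply: eq_bigr => p /andP[_ /eqP->].
rewrite -(@partition_big _ _ _ _ _ _ (perm_on (rcol v (w a))) (fun p => T (w a) (p a)) xpredT
  (fun p => Y (T (w a) (p a)) a' * ((-1) ^+ p * DK p))) //=.
rewrite /exchange mulr_sumr -cover_rcol_a; apply: eq_bigr => p hp.
have eR : \prod_(j | (j != w a) && (j != w b)) minor Y (rcol w j) (kap j) (relift T p j) =
   \prod_(j | (j != w a) && (j != w b)) minor Y (rcol w j) (kap j) (relift T 1 j).
  by apply: eq_bigr => j /andP[/negbTE ja /negbTE jb]; rewrite !ffunE ja jb.
have eA : minor Y (rcol w (w a)) (kap (w a)) (relift T p (w a)) =
    minor Y P' id (fun s => T (w a) (p s)).
  apply: eq_minor => s _; last by rewrite ffunE eqxx ffunE.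
  by rewrite /kap /moves in_rcol ltnNge (ltnW ab'').
have eB : minor Y (rcol w (w b)) (kap (w b)) (relift T p (w b)) =
    minor Y (P :|: I) (kap (w b)) (fun s => if s \in I then T (w a) (p s) else T (w b) s).
  rewrite [X in minor _ X _ _]cover_rcol_b; apply: eq_minor => // s _.
  by rewrite ffunE (negbTE wab') eqxx ffunE.
have eD : DK p = _ := prod_cover_split (fun j => minor Y (rcol w j) (kap j) (relift T p j)).
rewrite eD eR eA eB.
have R (B : comNzRingType) (x e q m1 m2 : B) : x * (e * (q * (m1 * m2))) = q * (e * (x * m1 * m2)).
  by ring.
exact: R.
Qed.

(** Here column [w b] is not moved either, so [exchange_id] applies; N counts the permutations of P'
    and of I. *)
Lemma functional_lift_diag T : exists2 N : nat, (0 < N)%N &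
  functional a b (cover_lift T) = N%:R * Delta Y v T.
Proof.
exists (#|[set r : 'S_n | perm_on P' r]| * #|[set t : 'S_n | perm_on I t]|)%N.
  rewrite muln_gt0; apply/andP; split; apply/card_gt0P; exists 1%g;
  by rewrite inE perm_on1.
rewrite (functional_lift T ab ab) /=.
have -> : moves a b (rcol w (w b)) = false by rewrite /moves in_rcol ltnn.
rewrite exchange_id ?cover_sub ?cover_disjoint ?cover_a_P' ?cover_a_I //.
rewrite mulrCA; congr (_ * _).
have eD : Delta Y v T = _ := prod_cover_split (fun j => minor Y (rcol v j) id (T j)).
rewrite eD cover_aboveE cover_rcol_a [minor _ P _ _ * _]mulrC; congr (_ * _).
apply: eq_bigr => j /andP[ja jb]; rewrite cover_rcol_other // ffunE (negbTE ja) (negbTE jb).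
case: ifP => // mv; rewrite minor_relabel.
move: mv => /andP[bj aj]; apply: eq_minor => s sS; last by rewrite ffunE.
rewrite /repl; case: tpermP => [e|->|/eqP/negbTE _ /eqP/negbTE->//].
  by rewrite e (negbTE aj) in sS.
by rewrite eqxx.
Qed.

(* Since both pairs are covers, a nonzero value forces (a', b') to come after (a, b)
   in the order of decreasing w a, then increasing b. *)
Lemma functional_lift_off T (a' b' : 'I_n) : cov w a' b' -> (a < b')%N -> (a' < b)%N ->
  (w a < w a')%N || (a' == a) && (b' < b)%N -> functional a' b' (cover_lift T) = 0.
Proof.
move=> /covP [ab' wab' hc'] ab'' a'b h.
rewrite (functional_lift T ab' ab'') /= exchange_eq0 ?mulr0 ?cover_sub ?cover_disjoint
  ?cover_a_P' ?cover_a_I //.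
- move=> s; rewrite inE => sP; case: ifP => // _; rewrite /repl; case: eqP => // e.
  by move: sP; rewrite e; lia.
move: h => /orP[h|/andP[/eqP ea hb]].
  (* A column a' to the left of a lies in P'. To the right of a, the cover condition pushes its
     value above w b, so it lies in I. *)
  rewrite in_rcol; case: (ltnP a' a) => [lt|ge]; first by left; rewrite h.
  right; have h1 := hc a'; have h2 : w a' != w b :> nat.
    by apply: perm_val_neq; rewrite -val_eqE /=; lia.
  have h3 : (a < a')%N.
    by rewrite ltn_neqAle ge andbT; apply: contraTneq h => /val_inj->; rewrite ltnn.
  exists a'; first by rewrite inE; lia.
  by case: ifP => // _; rewrite /repl; case: eqP.
have nb : (w b' != w b :> nat).
  by apply: perm_val_neq; rewrite -val_eqE /= neq_ltn hb.
have hb' := hc b'; rewrite ea in wab'.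
(* Now b' lies in I and column [w b] moves, so b' is replaced by a'. *)
right; exists b'; first by rewrite inE; lia.
rewrite /moves !in_rcol ea.
have -> : (b' < b)%N && (w b < w b')%N && ~~ ((a < b)%N && (w b < w a)%N) by lia.
by rewrite /repl eqxx.
Qed.

Hypothesis Ylow : forall i j : 'I_n, (j < i)%N -> Y i j = 0.

(* Row c cannot be spared: the first a columns need all of the rows below a. *)
Lemma cover_lift_lrmin T c : (forall h : 'I_n, (h < a)%N -> (w a < w h)%N) ->
  Delta Y v T != 0 -> (c < a)%N -> cover_lift T c = 0.
Proof.
move=> lrmin nz ca; rewrite ffunE; apply: big1 => p /andP[hp /eqP ec].
have P'E (i : 'I_n) : (i \in P') = (i < a)%N.
  by rewrite in_rcol; case: ltnP => // /lrmin.
have nzS : minor Y (rcol v (w a)) id (T (w a)) != 0.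
  by apply: contraNneq nz => e; rewrite /Delta (bigD1 (w a)) //= e mul0r.
have inj : {in rcol v (w a) &, injective (T (w a))}.
  move=> s t sS tS e; apply/eqP; apply: contraNT nzS => st.
  by rewrite (@minor_row_alt _ _ Y two_torsion_free _ id _ _ _ sS tS st e).
suff e0 : minor Y (rcol w (w a)) id (relift T p (w a)) = 0.
  by rewrite /Delta (bigD1 (w a)) //= e0 mul0r mulr0.
apply: big1 => r hr; rewrite -/P' in hr *.
case: (boolP [exists s in P', (s < T (w a) (p (r s)))%N]) => [/exists_inP[s sP lt]|].
  by rewrite (bigD1 s) //= ffunE eqxx ffunE Ylow // mul0r mulr0.
(* Otherwise the rows f s <= s exhaust all rows below a. So c is the row of a slot in P' as well as
   that of slot a, against injectivity. *)
rewrite negb_exists_in => /forall_inP le; exfalso.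
have S'P (s : 'I_n) : s \in P' -> s \in rcol v (w a) by rewrite cover_rcol_a !inE => ->; rewrite orbT.
pose f s := T (w a) (p (r s)).
have finj : {in P' &, injective f}.
  move=> s t sP tP e; apply: (@perm_inj _ r); apply: (@perm_inj _ p); apply: inj => //;
  by rewrite perm_closed //; apply: S'P; rewrite perm_closed.
have fP : f @: P' = P'.
  apply/eqP; rewrite eqEcard card_in_imset // leqnn andbT.
  apply/subsetP => _ /imsetP[s sP ->]; have := le s sP; rewrite -leqNgt !P'E /f => h.
  by apply: leq_ltn_trans h _; rewrite -P'E.
have : c \in f @: P' by rewrite fP P'E.
move=> /imsetP[s sP]; rewrite -ec => e.
have rsP : r s \in P' by rewrite perm_closed.
have aS : a \in rcol v (w a) by rewrite cover_rcol_a !inE eqxx.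
have rsS := S'P _ rsP.
have : a = r s.
  apply: (@perm_inj _ p); apply: inj; last exact: e.
  - by rewrite perm_closed.
  - by rewrite perm_closed.
by move=> e'; move: rsP; rewrite -e' P'E ltnn.
Qed.

End Cover.
End Lifts.


Lemma card_dep_pairs (I J : finType) (X : {set I}) (B : I -> {set J}) :
  #|[set x : I * J | (x.1 \in X) && (x.2 \in B x.1)]| = (\sum_(i in X) #|B i|)%N.
Proof.
rewrite -sum1_card; under eq_bigl => x do rewrite inE.
rewrite -(pair_big_dep (mem X) (fun i => mem (B i)) (fun _ _ => 1%N)) /=.
by apply: eq_bigr => i _; rewrite sum1_card.
Qed.

Lemma sum_dep_pairs (V : nmodType) (I J : finType) (X : {set I}) (B : I -> {set J})
    (G : I * J -> V) :
  \sum_(z in [set z : I * J | (z.1 \in X) && (z.2 \in B z.1)]) G z =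
  \sum_(i in X) \sum_(j in B i) G (i, j).
Proof. by rewrite pair_big_dep; apply: eq_big => [z|[i j] _] //; rewrite inE. Qed.

(** * Monk's rule as an inequality between ranks *)

Section Ranks.
Variables (A : comAlgType rat) (n : nat) (Y : 'M[A]_n).
Variable ph : 'I_n -> 'I_n -> {rmorphism A -> {poly A}}.
Hypothesis phY : forall a b : 'I_n, (a < b)%N -> map_mx (ph a b) Y = shift Y a b.
Hypothesis phZ : forall a b z f, ph a b (z *: f) = z%:A%:P * ph a b f.
Hypothesis Ylow : forall i j : 'I_n, (j < i)%N -> Y i j = 0.
Implicit Types (w : 'S_n) (T : filling n) (x y : 'I_n * 'I_n) (al : 'X_{1..n}).
Local Notation RV := {ffun 'I_n -> A}.

Lemma rat_algebra_torsion_free (x : A) : x = - x -> x = 0.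
Proof.
move=> e; have e2 : (2%:R : rat) *: x = 0.
  by rewrite scaler_nat mulr2n -[X in _ + X]opprK -e subrr.
by have := congr1 (GRing.scale (2%:R^-1)) e2; rewrite scalerA mulVf // scale1r scaler0.
Qed.

Definition rk w al : nat := lrank (Delta Y w) [set T | weight w T == al].

Definition swap x w : 'S_n := (tperm x.1 x.2 * w)%g.

Lemma functional_sum w a b (J : finType) (Q : pred J) (z : J -> rat) (g : J -> RV) :
  functional Y ph w a b (\sum_(i | Q i) z i *: g i) =
  \sum_(i | Q i) z i *: functional Y ph w a b (g i).
Proof.
rewrite /functional; under [RHS]eq_bigr => i _ do rewrite scaler_sumr.
rewrite exchange_big /=; apply: eq_bigr => c _.
rewrite sum_ffunE rmorph_sum coef_sum mulr_sumr; apply: eq_bigr => i _.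
by rewrite ffunE /= phZ coefCM mulr_algl scalerAr.
Qed.

Section LiftFree.
Variables (w : 'S_n) (X : {set 'I_n * 'I_n}) (Q : pred 'I_n) (q : 'I_n).
Variable B : 'I_n * 'I_n -> {set filling n}.
Hypothesis Xcov : forall x, x \in X -> [/\ cov w x.1 x.2, (x.1 <= q)%N & (q < x.2)%N].
Hypothesis Bfree : forall x, x \in X -> lfree (Delta Y (swap x w)) (B x).
Hypothesis Qlift : forall x y T c, x \in X -> y \in X -> T \in B y -> ~~ Q c ->
  Y c x.1 = 0 \/ cover_lift Y w y.1 y.2 T c = 0.

(** The lift cut down to the rows c in Q, those whose variables appear in the inequality. By [Qlift]
    the functionals do not see the difference. *)
Definition tlift (z : ('I_n * 'I_n) * filling n) : RV :=
  [ffun c => if Q c then cover_lift Y w z.1.1 z.1.2 z.2 c else 0].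

Lemma functional_tlift x y T : x \in X -> y \in X -> T \in B y ->
  functional Y ph w x.1 x.2 (tlift (y, T)) =
  functional Y ph w x.1 x.2 (cover_lift Y w y.1 y.2 T).
Proof.
move=> xX yX TB; apply: eq_bigr => c _; rewrite ffunE /=; case: ifPn => // nQ.
by case: (Qlift xX yX TB nQ) => ->; rewrite ?mul0r // !(rmorph0, coef0).
Qed.

(** Since [n - x.2] is less than [n.+1], larger keys mean larger w a, then smaller b. *)
Let key x := (w x.1 * n.+1 + (n - x.2))%N.

(** Triangularity. Apply the functional of x to a relation: terms with larger key vanish by
    induction, the other terms with y distinct from x by [functional_lift_off], whose position
    conditions hold because all pairs straddle q. What is left is a relation among the independent
    [Delta Y (swap x w)]. *)
Lemma tlift_free : lfree tlift [set z | (z.1 \in X) && (z.2 \in B z.1)].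
Proof.
move=> c sum0 [x T]; rewrite inE /= => /andP[xX]; move: T.
have [d] := ubnP (n * n.+1 + n - key x)%N; elim: d x xX => // d IH x xX hd.
have [covx xq qx] := Xcov xX.
have hN T : exists N : nat, (0 < N)%N /\ functional Y ph w x.1 x.2 (cover_lift Y w x.1 x.2 T) =
    N%:R * Delta Y (swap x w) T.
  have [N N0 e] := functional_lift_diag rat_algebra_torsion_free phY covx T.
  by exists N.
pose N T := proj1_sig (constructive_indefinite_description _ (hN T)).
have NP T : (0 < N T)%N /\ functional Y ph w x.1 x.2 (cover_lift Y w x.1 x.2 T) =
    (N T)%:R * Delta Y (swap x w) T.
  exact: (proj2_sig (constructive_indefinite_description _ (hN T))).
have : functional Y ph w x.1 x.2 (\sum_(z in [set z | (z.1 \in X) && (z.2 \in B z.1)])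
    c z *: tlift z) = 0.
  by rewrite sum0 /functional big1 // => i _; rewrite ffunE rmorph0 coef0 mulr0.
rewrite functional_sum sum_dep_pairs (bigD1 x) //= [X in _ + X]big1 ?addr0; last first.
  move=> y /andP[yX yx]; apply: big1 => T TB.
  have [covy yq qy] := Xcov yX.
  have bx : (x.2 <= n)%N by apply: ltnW.
  have by_ : (y.2 <= n)%N by apply: ltnW.
  have wyn : (w y.1 < n)%N by [].
  case: (ltnP (key x) (key y)) => [lt|le].
    rewrite (IH y) ?scale0r //; apply: leq_trans _ (hd : _ <= d)%N.
    suff : (key y <= n * n.+1 + n)%N by lia.
    by apply: leq_add (leq_subr _ _); rewrite leq_mul2r (ltnW wyn) orbT.
  rewrite functional_tlift // (functional_lift_off rat_algebra_torsion_free phY covy) ?scaler0 //.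
  - exact: leq_ltn_trans yq qx.
  - exact: leq_ltn_trans xq qy.
  case: (ltngtP (w y.1) (w x.1)) => //= [lt|e].
    have : ((w x.1).+1 * n.+1 <= w y.1 * n.+1)%N by rewrite leq_mul2r lt orbT.
    move: le; rewrite /key mulSn.
    by move: (w x.1 * n.+1)%N (w y.1 * n.+1)%N (nat_of_ord x.2) (nat_of_ord y.2) => *; lia.
  have e1 : x.1 = y.1 by apply: (@perm_inj _ w); apply: val_inj.
  rewrite e1 eqxx /=; have : x.2 != y.2 :> nat.
    by apply: contraNneq yx => /val_inj e2; case: (x) (y) e1 e2 => ? ? [? ?] /= -> ->.
  move: le bx by_; rewrite /key e1 leq_add2l.
  by move: (nat_of_ord x.2) (nat_of_ord y.2) => *; lia.
move=> e T TB.
have : c (x, T) * (N T)%:R = 0.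
  apply: (Bfree xX (c := fun T => c (x, T) * (N T)%:R)) => //; rewrite -[RHS]e.
  apply: eq_bigr => T' TB'; rewrite functional_tlift // (NP T').2.
  by rewrite mulr_natl -scaler_nat scalerA.
move/eqP; rewrite mulf_eq0 => /orP[/eqP//|].
by rewrite pnatr_eq0; have := (NP T).1; case: (N T).
Qed.

End LiftFree.

Lemma lfree_neq0 (V : lmodType rat) (J : finType) (v : J -> V) (B : {set J}) i :
  lfree v B -> i \in B -> v i != 0.
Proof.
move=> fB iB; apply/eqP => e; have s0 : \sum_(j in B) (j == i)%:R *: v j = 0.
  rewrite (bigD1 i) //= e scaler0 big1 ?addr0 // => j /andP[_ /negbTE->].
  by rewrite scale0r.
by have /eqP := fB _ s0 i iB; rewrite eqxx oner_eq0.
Qed.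

Lemma rk_basis w al : exists B : {set filling n}, [/\ forall T, T \in B -> weight w T = al,
  lfree (Delta Y w) B, #|B| = rk w al &
  forall T, weight w T = al -> spans (Delta Y w) B (Delta Y w T)].
Proof.
have [B [sB fB cB spB]] := lrank_basis (Delta Y w) [set T | weight w T == al].
exists B; split=> // [T /(subsetP sB)|T e]; first by rewrite inE => /eqP.
by apply: spB; rewrite inE e.
Qed.

Definition single (c : 'I_n) (f : A) : RV := [ffun c' => if c' == c then f else 0].

Lemma tlift_single w (Q : pred 'I_n) x T : tlift w Q (x, T) =
  \sum_(p : 'S_n | perm_on (rcol (swap x w) (w x.1)) p && Q (T (w x.1) (p x.1)))
    ((-1) ^+ p : rat) *: single (T (w x.1) (p x.1)) (Delta Y w (relift w x.1 x.2 T p)).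
Proof.
apply/ffunP => c; rewrite sum_ffunE ffunE /= ffunE.
rewrite big_mkcondr [RHS]big_mkcondr /=.
case: ifPn => Qc; last first.
  rewrite big1 // => p _; case: ifP => // Qp; rewrite !ffunE.
  by case: eqP => [e|]; [rewrite e Qp in Qc|rewrite scaler0].
apply: eq_bigr => p _; rewrite eq_sym; case: eqP => [<-|ne].
  by rewrite Qc !ffunE eqxx scaler_sign mulr_sign.
by case: ifP => // _; rewrite !ffunE; case: eqP => // _; rewrite scaler0.
Qed.

(** The independent lifts lie in a direct sum over c of the spans of the [Delta Y w T] of weight
    [al - U_(c)], whose dimension is the right-hand side. *)
Lemma rk_cover_le w (X : {set 'I_n * 'I_n}) (Q : pred 'I_n) (q : 'I_n) al :
  (forall x, x \in X -> [/\ cov w x.1 x.2, (x.1 <= q)%N & (q < x.2)%N]) ->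
  (forall x y T c, x \in X -> y \in X -> Delta Y (swap y w) T != 0 -> ~~ Q c ->
     Y c x.1 = 0 \/ cover_lift Y w y.1 y.2 T c = 0) ->
  (\sum_(x in X) rk (swap x w) al <=
   \sum_(c | Q c && (U_(c) <= al)%MM) rk w (al - U_(c))%MM)%N.
Proof.
move=> Xcov Qlift.
pose bas u be := proj1_sig (constructive_indefinite_description _ (rk_basis u be)).
have basP u be : [/\ forall T, T \in bas u be -> weight u T = be,
  lfree (Delta Y u) (bas u be), #|bas u be| = rk u be &
  forall T, weight u T = be -> spans (Delta Y u) (bas u be) (Delta Y u T)].
  exact: (proj2_sig (constructive_indefinite_description _ (rk_basis u be))).
pose B x := bas (swap x w) al.
pose Z := [set c : 'I_n | Q c && (U_(c) <= al)%MM].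
pose B' c := bas w (al - U_(c))%MM.
have fB : lfree (tlift w Q) [set z | (z.1 \in X) && (z.2 \in B z.1)].
  apply: (@tlift_free w X Q q B) => // [x _|x y T c xX yX TB nQ].
    by case: (basP (swap x w) al).
  apply: Qlift => //; case: (basP (swap y w) al) => _ fy _ _.
  exact: lfree_neq0 fy TB.
pose u (z : 'I_n * filling n) := single z.1 (Delta Y w z.2).
have -> : (\sum_(x in X) rk (swap x w) al = #|[set z | (z.1 \in X) && (z.2 \in B z.1)]|)%N.
  by rewrite card_dep_pairs; apply: eq_bigr => x _; case: (basP (swap x w) al).
have -> : (\sum_(c | Q c && (U_(c) <= al)%MM) rk w (al - U_(c))%MM =
           #|[set z | (z.1 \in Z) && (z.2 \in B' z.1)]|)%N.
  rewrite card_dep_pairs; apply: eq_big => [c|c _]; first by rewrite inE.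
  by case: (basP w (al - U_(c))%MM).
apply: (steinitz (u := u) fB) => -[x T]; rewrite inE /= => /andP[xX TB].
have [covx _ _] := Xcov x xX; have [/(_ T TB) wT _ _ _] := basP (swap x w) al.
rewrite tlift_single; apply: spans_sum => p /andP[hp Qp].
have := weight_relift covx T hp; rewrite -/(swap x w) wT.
set c := T (w x.1) (p x.1) in Qp *; set T' := relift _ _ _ _ _ => wE.
have cal : (U_(c) <= al)%MM by rewrite -wE lem_addl.
have wT' : weight w T' = (al - U_(c))%MM by rewrite -wE addmK.
have [_ _ _ /(_ T' wT')[e ->]] := basP w (al - U_(c))%MM.
exists (fun z => if z.1 == c then e z.2 else 0).
rewrite sum_dep_pairs (bigD1 c) ?inE ?Qp //= [X in _ + X]big1 ?addr0; last first.
  by move=> c' /andP[_ /negbTE ne]; apply: big1 => S _; rewrite ne scale0r.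
rewrite eqxx; apply/ffunP => c'; rewrite ffunE sum_ffunE.
case: ifPn => [/eqP->|ne].
  by apply: eq_bigr => S _; rewrite !ffunE eqxx.
by rewrite big1 // => S _; rewrite !ffunE (negbTE ne) scaler0.
Qed.

Lemma rk_monk w (q : 'I_n) al :
  (\sum_(x : 'I_n * 'I_n | cov w x.1 x.2 && (x.1 <= q < x.2)%N) rk (swap x w) al <=
   \sum_(c : 'I_n | (c <= q)%N && (U_(c) <= al)%MM) rk w (al - U_(c))%MM)%N.
Proof.
pose X := [set x : 'I_n * 'I_n | cov w x.1 x.2 && (x.1 <= q < x.2)%N].
rewrite (eq_bigl (fun x => x \in X)); last by move=> x; rewrite inE.
apply: (@rk_cover_le w X (fun c : 'I_n => c <= q)%N q) => [x|x y T c xX _ _ nQ].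
  by rewrite inE => /and3P[].
left; apply: Ylow; rewrite -ltnNge in nQ; apply: leq_ltn_trans nQ.
by move: xX; rewrite inE => /and3P[].
Qed.

(** Only c = i is kept: rows c > i vanish by triangularity of Y, rows c < i by
    [cover_lift_lrmin]. *)
Lemma rk_lrmin w (i : 'I_n) al : (forall h : 'I_n, (h < i)%N -> (w i < w h)%N) ->
  (\sum_(j | cov w i j) rk (tperm i j * w)%g (al + U_(i))%MM <= rk w al)%N.
Proof.
move=> lrmin; pose X := [set x : 'I_n * 'I_n | (x.1 == i) && cov w x.1 x.2].
have XP x : x \in X -> x.1 = i /\ cov w x.1 x.2 by rewrite inE => /andP[/eqP].
have -> : (\sum_(j | cov w i j) rk (tperm i j * w)%g (al + U_(i))%MM =
   \sum_(x in X) rk (swap x w) (al + U_(i))%MM)%N.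
  rewrite (reindex_onto (fun j : 'I_n => (i, j)) snd) /=; last first.
    by move=> [a b] /XP[/= -> _].
  by apply: eq_bigl => j; rewrite inE /= !eqxx andbT.
have := @rk_cover_le w X (pred1 i) i (al + U_(i))%MM.
rewrite (big_pred1 i) => [|c]; last first.
  by rewrite /=; case: eqP => // ->; rewrite lem_addl.
rewrite addmK; apply => [x /XP[e c]|x y T c /XP[-> _] /XP[ey cy] nz /= ci].
  by split=> //; [rewrite e|rewrite -e; case/covP: c].
case: (ltngtP c i) => [lt|gt|/val_inj e]; last by rewrite e eqxx in ci.
  right; apply: (cover_lift_lrmin rat_algebra_torsion_free cy Ylow) => //; last by rewrite ey.
  by rewrite ey.
by left; apply: Ylow.
Qed.
End Ranks.


Lemma mcoeffXUM n (R : comNzRingType) (i : 'I_n) (f : {mpoly R[n]}) al :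
  ('X_i * f)@_al = if (U_(i) <= al)%MM then f@_(al - U_(i))%MM else 0.
Proof.
case: ifPn => h; first by rewrite -{1}(submK h) addmC mulrC mcoeffMX.
apply: memN_msupp_eq0; apply: contra h => /msuppM_le /allpairsP [[m1 m2]] /= [+ _ ->].
by rewrite msuppX inE => /eqP->; rewrite lem_addr.
Qed.

(** * Ranks equal Schubert coefficients *)

Section Sandwich.
Variables (n : nat) (rk : 'S_n -> 'X_{1..n} -> nat).
Implicit Types (u w : 'S_n) (i j q : 'I_n) (al : 'X_{1..n}).
Local Notation swap x w := (tperm x.1 x.2 * w)%g.
Local Opaque schubert.

Hypothesis rk_monk : forall w q al,
  (\sum_(x : 'I_n * 'I_n | cov w x.1 x.2 && (x.1 <= q < x.2)%N) rk (swap x w) al <=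
   \sum_(c : 'I_n | (c <= q)%N && (U_(c) <= al)%MM) rk w (al - U_(c))%MM)%N.
Hypothesis rk_lrmin : forall w i al, (forall h : 'I_n, (h < i)%N -> (w i < w h)%N) ->
  (\sum_(j | cov w i j) rk (tperm i j * w)%g (al + U_(i))%MM <= rk w al)%N.
Hypothesis rk_top : forall w, ascent w = None -> (0 < rk w [multinom (n.-1 - k)%N | k < n])%N.
Hypothesis rk_id : forall al, (rk 1%g al <= (al == 0%MM))%N.

(** A measure for the downward induction: a cover lowers it by (b - a)(w b - w a). *)
Definition moment w : nat := (\sum_(i < n) i * w i)%N.

Lemma moment_cov w a b : cov w a b -> (moment (tperm a b * w)%g < moment w)%N.
Proof.
move=> /covP [ab wab _]; have ne : b != a by rewrite -val_eqE /=; lia.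
have D v : (moment v = a * v a + (b * v b + \sum_(i < n | (i != a) && (i != b)) i * v i))%N.
  by rewrite /moment (bigD1 a) //= (bigD1 b).
rewrite !D !permM tpermL tpermR.
have -> : (\sum_(i < n | (i != a) && (i != b)) i * (tperm a b * w)%g i =
           \sum_(i < n | (i != a) && (i != b)) i * w i)%N.
  by apply: eq_bigr => i /andP[ia ib]; rewrite permM tpermD // eq_sym.
move: (\sum_(i | _) _)%N (nat_of_ord a) (nat_of_ord b) (nat_of_ord (w a)) (nat_of_ord (w b)) ab wab.
by move=> {D ne} s x y z t; nia.
Qed.

(** Take the position of the least value up to p. Nothing smaller stands to its left, so Monk's rule
    has no negative terms. *)
Lemma lrmin_ex w p : ascent w = Some p -> exists i, [/\
  forall h : 'I_n, (h < i)%N -> (w i < w h)%N,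
  exists2 b : 'I_n, (i < b)%N & (w i < w b)%N &
  schubert w * 'X_i = \sum_(b | cov w i b) schubert (tperm i b * w)%g].
Proof.
move=> /ascent_some [hp wp]; have np := nextiE hp.
case: (@arg_minnP _ p (fun i : 'I_n => i <= p)%N (fun i => w i) (leqnn p)) => i ip imin.
exists i.
have lr (h : 'I_n) : (h < i)%N -> (w i < w h)%N.
  move=> hi; have := imin h (ltnW (leq_trans hi ip)).
  rewrite leq_eqVlt => /orP[/eqP/val_inj/perm_inj e|//]; by rewrite e ltnn in hi.
have ex : exists2 b : 'I_n, (i < b)%N & (w i < w b)%N.
  exists (nexti p); first by rewrite np ltnS.
  by apply: leq_ltn_trans wp; apply: imin.
split=> //; rewrite mulrC monkP // /monk [X in _ - X]big_pred0 ?subr0 // => a.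
by apply/negP => /covP [ai wai _]; have := lr a ai; lia.
Qed.

Lemma cov_ex w i : (exists2 b : 'I_n, (i < b)%N & (w i < w b)%N) -> exists b, cov w i b.
Proof.
move=> [b0 ib0 wb0].
have P0 : (i < b0)%N && (w i < w b0)%N by rewrite ib0.
case: (@arg_minnP _ b0 (fun b : 'I_n => (i < b) && (w i < w b))%N (fun b => b) P0).
move=> b /andP[ib wib] bmin; exists b; apply/covP; split=> // c; apply/negP => /and4P[ic cb wic _].
by have := bmin c; rewrite ic wic => /(_ isT); rewrite leqNgt cb.
Qed.

Lemma schub_ge0_neq0 w : (forall al, 0 <= (schubert w)@_al) /\ schubert w != 0.
Proof.
have [d] := ubnP (moment w); elim: d w => // d IH w hd.
case E : (ascent w) => [p|]; last first.
  rewrite schub_pick E schub_topE -msupp_eq0 msuppX; split=> // al.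
  by rewrite mcoeffX ler0n.
have [i [lr ex eS]] := lrmin_ex E.
have IHb b : cov w i b -> (forall al, 0 <= (schubert (tperm i b * w)%g)@_al) /\
    schubert (tperm i b * w)%g != 0.
  by move=> cb; apply: IH; apply: leq_trans (moment_cov cb) _.
split=> [al|].
  have <- := mcoeffMX (schubert w) U_(i) al; rewrite eS raddf_sum /=.
  by apply: sumr_ge0 => b /IHb[].
have [b cb] := cov_ex ex; have [nn nz] := IHb _ cb.
apply: contraNneq nz => e; rewrite e mul0r in eS.
apply/eqP/mpolyP => al; rewrite mcoeff0; apply/eqP.
have /eqP := congr1 (mcoeff al) (esym eS); rewrite raddf_sum mcoeff0 /=.
rewrite psumr_eq0 => [/allP/(_ b)|c /IHb[]//].
by rewrite mem_index_enum cb => /(_ isT).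
Qed.

Lemma schub_le_rk w al : (schubert w)@_al <= (rk w al)%:Z.
Proof.
have [d] := ubnP (moment w); elim: d w al => // d IH w al hd.
case E : (ascent w) => [p|]; last first.
  rewrite schub_pick E schub_topE mcoeffX; case: eqP => [<-|_] //.
  by have := rk_top E; case: (rk _ _).
have [i [lr ex eS]] := lrmin_ex E.
have <- := mcoeffMX (schubert w) U_(i) al; rewrite eS raddf_sum /=.
apply: le_trans (_ : (\sum_(b | cov w i b) rk (tperm i b * w)%g (al + U_(i))%MM)%N%:Z <= _).
  rewrite (big_morph Posz PoszD (erefl _)) addmC; apply: ler_sum => b cb.
  by apply: IH; apply: leq_trans (moment_cov cb) _.
by rewrite lez_nat; apply: rk_lrmin.
Qed.

(** The coefficients lie between 0 and rk, which is at most 1 at weight zero and 0 elsewhere; as the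
    polynomial is nonzero, everything is equal. *)
Lemma schub_id al : (schubert 1%g)@_al = (rk 1%g al)%:Z.
Proof.
have [nn nz] := schub_ge0_neq0 1%g.
have le be := schub_le_rk 1%g be; have h := rk_id.
case: (eqVneq al 0%MM) => [->|ne]; last first.
  by have := h al; have := le al; have := nn al; rewrite (negbTE ne); lia.
have : (schubert (1%g : 'S_n))@_0%MM != 0.
  apply: contraNneq nz => e; apply/eqP/mpolyP => be; rewrite mcoeff0.
  case: (eqVneq be 0%MM) => [->//|ne].
  by have := h be; have := le be; have := nn be; rewrite (negbTE ne); lia.
by have := h 0%MM; have := le 0%MM; have := nn 0%MM; rewrite eqxx; lia.
Qed.

Lemma no_descent_id w : (forall q, (q.+1 < n)%N -> (w q < w (nexti q))%N) -> w = 1%g.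
Proof.
move=> mono.
have le1 i : (w i <= i)%N.
  have [d] := ubnP (n - i)%N; elim: d i => // d IH i hd; have := ltn_ord i.
  case: (ltnP i.+1 n) => [hi _|hi lt]; last by have := ltn_ord (w i); lia.
  by have := mono i hi; have := IH (nexti i); rewrite nextiE //; lia.
have le2 i : (i <= w i)%N.
  case: i => m; elim: m => [|m IH] hm //=.
  have hm' : (m < n)%N by apply: ltnW.
  have e : nexti (Ordinal hm') = Ordinal hm by apply: val_inj; rewrite /= nextiE.
  by have := mono (Ordinal hm') hm; rewrite e; have := IH hm'; rewrite /=; lia.
by apply/permP => i; rewrite perm1; apply/val_inj/eqP; rewrite eqn_leq le1 le2.
Qed.

(** A cover with both positions at most q occurs once with each sign; those straddling q remain. *)
Lemma monk_sum u q : (forall c : 'I_n, (c <= q)%N -> exists2 b : 'I_n, (c < b)%N & (u c < u b)%N) ->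
  \sum_(c : 'I_n | (c <= q)%N) 'X_c * schubert u =
  \sum_(x : 'I_n * 'I_n | cov u x.1 x.2 && (x.1 <= q < x.2)%N) schubert (swap x u).
Proof.
move=> ex; rewrite (eq_bigr (monk u)); last by move=> c cq; rewrite monkP //; apply: ex.
rewrite /monk sumrB !pair_big_dep /=.
rewrite [X in _ - X](reindex_inj (h := fun x : 'I_n * 'I_n => (x.2, x.1))) /=; last first.
  by move=> [a b] [c d] /= [-> ->].
rewrite (bigID (fun x : 'I_n * 'I_n => x.2 <= q)%N) /=.
rewrite [X in X + _ - _](eq_bigl (fun x : 'I_n * 'I_n => (x.2 <= q)%N && cov u x.1 x.2)).
  by rewrite addrAC subrr add0r; apply: eq_bigl => x; rewrite -ltnNge -andbA andbCA.
move=> x; case: (boolP (cov u x.1 x.2)) => [/covP[lt _ _]|_]; last by rewrite !andbF.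
by rewrite !andbT; lia.
Qed.

Theorem schub_rk w al : (schubert w)@_al = (rk w al)%:Z.
Proof.
have [d] := ubnP (len w); elim: d w al => // d IH w al hd.
case: (eqVneq w 1%g) => [->|w1]; first exact: schub_id.
(* If the maximum of w is not in the last position, q is its position and [stp q] moves it to q+1.
   Otherwise any descent q serves, as the maximum stays last. *)
have [q [hq desc [M qM uM]]] : exists q, [/\ (q.+1 < n)%N, (w (nexti q) < w q)%N &
    exists2 M : 'I_n, (q < M)%N & forall c, ((stp q * w)%g c <= (stp q * w)%g M)%N].
  have maxM : exists m : 'I_n, forall c, (w c <= w m)%N.
    have n0 : (0 < n)%N.
      case: n w w1 {IH hd} => // w /eqP; case; by apply/permP => -[].
    have hl : (n.-1 < n)%N by rewrite prednK.
    exists ((w^-1)%g (Ordinal hl)) => c; rewrite permKV /=.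
    by have := ltn_ord (w c); lia.
  have [m wm] := maxM; case: (ltnP m.+1 n) => hm.
    have nm := nextiE hm; exists m; split=> //.
      by rewrite ltn_neqAle wm andbT; apply: perm_val_neq; rewrite eq_sym nexti_neq.
    exists (nexti m); first by rewrite nm.
    by move=> c; rewrite !permM {2}/stp tpermR; apply: wm.
  have [q /andP[hq dq]] : exists q, (q.+1 < n)%N && (w (nexti q) < w q)%N.
    apply/existsP; apply: contraR w1 => /existsPn no; apply/eqP/no_descent_id => q hq.
    have := no q; have := perm_val_neq w (nexti_neq hq); rewrite hq /=; lia.
  exists q; split=> //; exists m; first by have := ltn_ord m; lia.
  move=> c; rewrite !permM.
  have -> : stp q m = m; last exact: wm.
  have nq := nextiE hq; case: (stpP q m) => [e|e|//].
    by rewrite e in hm; lia.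
  by have := wm q; rewrite e; lia.
set u := (stp q * w)%g in uM.
have lu : len w = (len u).+1.
  by rewrite -[in LHS](stpM2 q w) len_stp // !permM /stp tpermL tpermR.
have uw : (tperm q (nexti q) * u = w)%g by rewrite -/(stp q) stpM2.
have ex (c : 'I_n) : (c <= q)%N -> exists2 b : 'I_n, (c < b)%N & (u c < u b)%N.
  move=> cq; have cM : (c < M)%N by apply: leq_ltn_trans qM.
  exists M => //; rewrite ltn_neqAle uM andbT; apply: perm_val_neq.
  by rewrite -val_eqE /= neq_ltn cM.
have eS := congr1 (mcoeff al) (monk_sum ex); rewrite !raddf_sum /= in eS.
have hx : cov u q (nexti q) && (q <= q < nexti q)%N.
  rewrite leqnn nextiE // ltnSn !andbT; apply: cov_next => //.
  by rewrite !permM /stp tpermL tpermR.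
have e1 : \sum_(c : 'I_n | (c <= q)%N) ('X_c * schubert u)@_al =
    (\sum_(c : 'I_n | (c <= q)%N && (U_(c) <= al)%MM) rk u (al - U_(c))%MM)%N%:Z.
  rewrite (big_morph Posz PoszD (erefl _)) [RHS]big_mkcondr /=; apply: eq_bigr => c _.
  rewrite mcoeffXUM; case: ifP => // _; apply: IH; lia.
(* w is one of the covers of u straddling q. A strict defect there, with S_v <= rk v for the others,
   would contradict [rk_monk]. *)
apply/eqP; rewrite eq_le schub_le_rk /= leNgt; apply/negP => lt.
have := rk_monk u q al; rewrite -lez_nat -e1 eS leNgt => /negP; apply.
rewrite (big_morph Posz PoszD (erefl _)).
rewrite (bigD1 (q, nexti q)) //= [ltRHS](bigD1 (q, nexti q)) //= uw.
by apply: ltr_leD => //; apply: ler_sum => x _; apply: schub_le_rk.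
Qed.

End Sandwich.


(** * Deleting a row and a column *)

Lemma ltn_lift n (h : 'I_n.+1) (i j : 'I_n) : (lift h i < lift h j)%N = (i < j)%N.
Proof. by rewrite /= /bump; lia. Qed.

Section BorderMinor.
Variables (A : comNzRingType) (n : nat) (k : 'I_n.+1) (Y : 'M[A]_n).

Definition border : 'M[A]_n.+1 := \matrix_(i, j)
  match unlift k i, unlift k j with
  | Some i', Some j' => Y i' j' | None, None => 1 | _, _ => 0 end.

Lemma border_low : (forall i j : 'I_n, (j < i)%N -> Y i j = 0) ->
  forall i j : 'I_n.+1, (j < i)%N -> border i j = 0.
Proof.
move=> Ylow i j; rewrite mxE.
case: (unliftP k i) => [i' ->|->]; case: (unliftP k j) => [j' ->|->] //; last by rewrite ltnn.
by rewrite ltn_lift; apply: Ylow.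
Qed.

Lemma fix_lift_perm (p : 'S_n.+1) : p k = k -> exists q : 'S_n, p = lift_perm k k q.
Proof.
move=> pk; have h x : {y | p (lift k x) = lift k y}.
  have : k != p (lift k x) by rewrite -{1}pk (inj_eq perm_inj) neq_lift.
  by move=> /unlift_some [y ey _]; exists y.
have inj : injective (fun x => sval (h x)).
  move=> x y; case: (h x) => x' ex; case: (h y) => y' ey /= e.
  by apply: (@lift_inj _ k); apply: (@perm_inj _ p); rewrite ex ey e.
exists (perm inj); apply/permP => x; case: (unliftP k x) => [y ->|->].
  by rewrite lift_perm_lift permE; case: (h y).
by rewrite lift_perm_id pk.
Qed.

(** If p moves k, the factor of column k is zero. The p that fix k come from 'S_n with the same
    sign, and column k, if present, contributes 1. *)
Lemma minor_border (S : {set 'I_n.+1}) (S' : {set 'I_n}) c c' :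
  (forall s, (lift k s \in S) = (s \in S')) -> c k = k ->
  (forall s, c (lift k s) = lift k (c' s)) ->
  minor border S id c = minor Y S' id c'.
Proof.
move=> SS' ck cl.
transitivity (\sum_(p : 'S_n.+1 | perm_on S p && (p k == k))
    (-1) ^+ p * \prod_(s in S) border (c (p s)) s).
  rewrite /minor big_mkcondr; apply: eq_bigr => p hp; case: eqP => // /eqP pk.
  have kS : k \in S by apply: contraNT pk => /(out_perm hp) ->.
  rewrite (bigD1 k) //= [border _ _]mxE unlift_none.
  case: (unliftP k (p k)) pk => [y ey|->]; last by rewrite eqxx.
  by rewrite ey cl liftK mul0r mulr0.
pose g p := odflt 1%g [pick q : 'S_n | p == lift_perm k k q].
have lpinj : injective (@lift_perm n k k).
  move=> p q e; apply/permP => x; apply: (@lift_inj _ k).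
  by rewrite -!(lift_perm_lift k k) e.
rewrite (reindex_onto (@lift_perm n k k) g) /=; last first.
  move=> p /andP[_ /eqP/fix_lift_perm[q ->]]; rewrite /g.
  by case: pickP => [q' /eqP/lpinj->//|/(_ q)]; rewrite eqxx.
apply: eq_big => [q|q _].
  rewrite lift_perm_id eqxx andbT.
  have -> : (g (lift_perm k k q) == q).
    by rewrite /g; case: pickP => [q' /eqP/lpinj->//|/(_ q)]; rewrite eqxx.
  rewrite andbT; apply/subsetP/subsetP => h x; rewrite inE => hx.
    by rewrite -SS'; apply: h; rewrite inE lift_perm_lift (inj_eq (@lift_inj _ k)).
  case: (unliftP k x) hx => [y ->|->]; last by rewrite lift_perm_id eqxx.
  by rewrite lift_perm_lift (inj_eq (@lift_inj _ k)) SS' => hy; apply: h; rewrite inE.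
rewrite odd_lift_perm addbb; congr (_ * _).
rewrite big_mkcond (bigD1_ord k) //= lift_perm_id ck mxE unlift_none if_same mul1r.
rewrite [RHS]big_mkcond /=; apply: eq_bigr => s _; rewrite SS'; case: ifP => // _.
by rewrite lift_perm_lift cl mxE !liftK.
Qed.

End BorderMinor.

Section Pattern.
Variables (n : nat) (w : 'S_n.+1) (k : 'I_n.+1) (sigma : 'S_n).
Hypothesis hsigma : forall i : 'I_n, w (lift k i) = lift (w k) (sigma i).

Lemma pattern_rcol j s : (lift k s \in rcol w (lift (w k) j)) = (s \in rcol sigma j).
Proof.
have -> : j = sigma ((sigma^-1)%g j) by rewrite permKV.
by rewrite -hsigma !in_rcol !hsigma !ltn_lift.
Qed.

Definition mlift (al : 'X_{1..n}) : 'X_{1..n.+1} := (\sum_(i < n) U_(lift k i) *+ al i)%MM.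

Definition mfactor : 'X_{1..n.+1} :=
  (\sum_(i < n.+1 | (k, i) \in rothe w) U_(k) + \sum_(i < n.+1 | (i, w k) \in rothe w) U_(i))%MM.

Lemma MfactorE : Mfactor w k = 'X_[mfactor].
Proof. by rewrite /Mfactor mpolyXD !mprodXE. Qed.

Lemma mliftD a b : mlift (a + b)%MM = (mlift a + mlift b)%MM.
Proof.
rewrite /mlift -big_split /=; apply: eq_bigr => i _; apply/mnmP => l.
by rewrite [RHS]mnmDE !mulmnE mnmDE mulnDr.
Qed.

Lemma mlift0 : mlift 0%MM = 0%MM.
Proof. by apply: big1 => i _; rewrite mnm0E mulm0n. Qed.

Lemma mliftU i : mlift U_(i) = U_(lift k i)%MM.
Proof.
rewrite /mlift (bigD1 i) //= mnm1E eqxx mulm1n big1 ?addm0 // => j ji.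
by rewrite mnm1E eq_sym (negbTE ji) mulm0n.
Qed.

Lemma mlift_inj : injective mlift.
Proof.
have E al i : mlift al (lift k i) = al i.
  rewrite /mlift mnm_sumE (bigD1 i) //= mulmnE mnm1E eqxx mul1n big1 ?addn0 // => j ji.
  by rewrite mulmnE mnm1E (inj_eq (@lift_inj _ k)) (negbTE ji).
by move=> a b e; apply/mnmP => i; rewrite -E e E.
Qed.

Lemma skipvarE (f : {mpoly int[n]}) : skipvar k f = \sum_(m <- msupp f) f@_m *: 'X_[mlift m].
Proof.
rewrite /skipvar /mmap; apply: eq_bigr => m _; rewrite mul_mpolyC; congr (_ *: _).
by rewrite /mmap1 /mlift mprodXnE.
Qed.

Definition extend (T : filling n) : filling n.+1 := [ffun j : 'I_n.+1 =>
  if unlift (w k) j is Some j' then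
    [ffun s : 'I_n.+1 => if unlift k s is Some s' then lift k (T j' s') else k]
  else [ffun s => s]].

(** Column [w k] gives the second product in M; each box of row k in another column gives a factor
    x_k. *)
Lemma weight_extend T : weight w (extend T) = (mfactor + mlift (weight sigma T))%MM.
Proof.
rewrite /weight (bigD1_ord (w k)) //= /mfactor [in RHS]addmC addmA.
have -> : (\sum_(s in rcol w (w k)) U_(extend T (w k) s) =
           \sum_(i < n.+1 | (i, w k) \in rothe w) U_(i))%MM.
  by apply: eq_big => s; rewrite ?inE // ffunE unlift_none ffunE.
rewrite [in RHS]addmC; congr (_ + _)%MM.
have -> : (\sum_(i < n.+1 | (k, i) \in rothe w) U_(k) =
    \sum_(j < n) if k \in rcol w (lift (w k) j) then U_(k) else 0)%MM.
  rewrite big_mkcond (bigD1_ord (w k)) //= inE /= ltnn andbF add0m.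
  by apply: eq_bigr => j _; rewrite [k \in rcol _ _]in_set.
rewrite (big_morph mlift mliftD mlift0) -big_split /=; apply: eq_bigr => j _.
rewrite big_mkcond (bigD1_ord k) //= addmC ffunE liftK ffunE unlift_none; congr (_ + _)%MM.
rewrite (big_morph mlift mliftD mlift0) [RHS]big_mkcond /=; apply: eq_bigr => s _.
by rewrite pattern_rcol ffunE liftK mliftU.
Qed.

Lemma extend_inj : injective extend.
Proof.
move=> T T' e; apply/ffunP => j; apply/ffunP => s; apply: (@lift_inj _ k).
have := congr1 (fun T : filling n.+1 => T (lift (w k) j) (lift k s)) e.
by rewrite !ffunE !liftK !ffunE !liftK.
Qed.

Section PatternRank.
Variables (A : comAlgType rat) (Y : 'M[A]_n.+1) (B : comAlgType rat) (Z : 'M[B]_n).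
Variable psi : {rmorphism A -> B}.
Hypothesis psiZ : forall z f, psi (z *: f) = z *: psi f.
Hypothesis psiY : map_mx psi Y = border k Z.
Hypothesis reg : forall x, minor (border k Z) (rcol w (w k)) id id * x = 0 -> x = 0.

Lemma psi_Delta T : psi (Delta Y w (extend T)) =
  minor (border k Z) (rcol w (w k)) id id * Delta Z sigma T.
Proof.
rewrite rmorph_prod (bigD1_ord (w k)) //= rmorph_minor /= psiY; congr (_ * _).
  by apply: eq_minor => // s _; rewrite ffunE unlift_none ffunE.
apply: eq_bigr => j _; rewrite rmorph_minor /= psiY.
apply: minor_border => [s||s]; first exact: pattern_rcol.
  by rewrite ffunE liftK ffunE unlift_none.
by rewrite ffunE liftK ffunE liftK.
Qed.

(** [psi] turns a relation among the extended fillings into the leading minor times a relation for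
    sigma, and [reg] cancels the minor. *)
Lemma rk_pattern al : (rk Z sigma al <= rk Y w (mfactor + mlift al)%MM)%N.
Proof.
have [C [wC fC <- _]] := rk_basis Z sigma al.
rewrite -(card_imset _ extend_inj); apply: lrank_max.
  apply/subsetP => _ /imsetP[T TC ->]; rewrite inE weight_extend wC //.
move=> c e _ /imsetP[T TC ->]; apply: (fC (fun T => c (extend T))) => //; apply: reg.
rewrite big_imset /= in e; last by move=> ? ? _ _; apply: extend_inj.
rewrite -[RHS](rmorph0 psi) -e rmorph_sum mulr_sumr.
by apply: eq_bigr => T' _; rewrite psiZ psi_Delta scalerAr.
Qed.

End PatternRank.
End Pattern.

(** * The generic case and the theorem *)

Section Generators.
Variable n : nat.

Definition phr (a b : 'I_n) : {rmorphism coordring n -> {poly coordring n}} := phi a b.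

Definition rkg := @rk (coordring n) n (gen n).

Lemma phr_gen (a b : 'I_n) : (a < b)%N -> map_mx (phr a b) (gen n) = shift (gen n) a b.
Proof. by move=> ab; rewrite [LHS]ysubst_gen //; apply: shift_low. Qed.

Lemma phr_scale (a b : 'I_n) z f : phr a b (z *: f) = z%:A%:P * phr a b f.
Proof. by rewrite [LHS]ysubst_scale alg_mpolyC. Qed.

Definition Tid : filling n := [ffun _ => [ffun s => s]].

Lemma Delta_id_neq0 (w : 'S_n) : Delta (gen n) w Tid != 0.
Proof.
apply/prodf_neq0 => j _.
have -> : minor (gen n) (rcol w j) id (Tid j) = minor (gen n) (rcol w j) id id.
  by apply: eq_minor => // s _; rewrite !ffunE.
by rewrite minor_gen_diag; apply/prodf_neq0 => s _; apply: gen_diag.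
Qed.

Lemma weight_id (w : 'S_n) : ascent w = None ->
  weight w Tid = [multinom (n.-1 - k)%N | k < n].
Proof.
move=> /ascent_none_anti anti; apply/mnmP => k; rewrite mnmE mnm_sumE.
transitivity (\sum_(c < n) (k < c)%N)%N.
  rewrite (reindex_inj (@perm_inj _ w)) /=; apply: eq_bigr => c _.
  rewrite mnm_sumE; under eq_bigr => s _ do rewrite !ffunE mnm1E.
  have -> : (k < c)%N = (k \in rcol w (w c)).
    by rewrite in_rcol; case: ltnP => // /anti ->.
  case: (boolP (k \in rcol w (w c))) => kc.
    rewrite (bigD1 k) //= eqxx big1 // => s /andP[_ sk]; by rewrite (negbTE sk).
  by rewrite big1 // => s sc; case: eqP => // e; rewrite e (negbTE kc) in sc.
rewrite -(big_mkord xpredT (fun c => nat_of_bool (k < c)%N)) (@big_cat_nat _ _ _ k.+1) //=.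
rewrite big_nat_cond big1 ?add0n; last first.
  by move=> c; rewrite andbT => /andP[_]; rewrite ltnS leqNgt => /negbTE->.
rewrite (eq_big_nat _ _ (F2 := fun=> 1%N)); last by move=> c /andP[-> _].
by rewrite sum_nat_const_nat muln1; lia.
Qed.

Lemma rkg_top (w : 'S_n) : ascent w = None ->
  (0 < rkg w [multinom (n.-1 - k)%N | k < n])%N.
Proof.
move=> h; have <- : #|[set Tid]| = 1%N by rewrite cards1.
apply: lrank_max; first by rewrite sub1set inE weight_id.
move=> c; rewrite big_set1 => /eqP; rewrite scaler_eq0 (negbTE (Delta_id_neq0 w)) orbF => /eqP e i.
by rewrite inE => /eqP->.
Qed.

(** The diagram is empty, so all fillings have weight zero and the same Delta. *)
Lemma rkg_id al : (rkg 1%g al <= (al == 0%MM))%N.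
Proof.
have rc0 (j : 'I_n) : rcol (1%g : 'S_n) j = set0.
  apply/setP => i; rewrite !inE /= invg1 !perm1; lia.
have w0 T : weight (1%g : 'S_n) T = 0%MM.
  by apply: big1 => j _; rewrite rc0 big_set0.
have D1 T : Delta (gen n) 1%g T = Delta (gen n) 1%g Tid.
  by apply: eq_bigr => j _; apply: eq_minor => // s; rewrite rc0 inE.
rewrite /rkg; have [C [wC fC <- _]] := rk_basis (gen n) 1%g al.
case: (set_0Vmem C) => [->|[T TC]]; first by rewrite cards0.
have := wC T TC; rewrite w0 => <-; rewrite eqxx -[nat_of_bool true]/1%N -(cards1 Tid).
apply: (steinitz (u := Delta (gen n) 1%g) fC) => T' _; exists (fun=> 1).
by rewrite big_set1 scale1r; apply: D1.
Qed.

Lemma schub_rkg (w : 'S_n) al : (schubert w)@_al = (rkg w al)%:Z.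
Proof.
apply: schub_rk => [u q be|u i be h|u h|be].
- exact: (rk_monk phr_gen phr_scale (@gen_low n)).
- exact: (rk_lrmin phr_gen phr_scale (@gen_low n)).
- exact: rkg_top.
- exact: rkg_id.
Qed.

End Generators.

Section Specialization.
Variables (n : nat) (k : 'I_n.+1).

Definition hmp : {rmorphism rat -> coordring n} := @mpolyC (n * n) rat.

Definition psi : {rmorphism coordring n.+1 -> coordring n} := ysubst hmp (border k (gen n)).

Lemma rkg_pattern (w : 'S_n.+1) (sigma : 'S_n) al :
  (forall i : 'I_n, w (lift k i) = lift (w k) (sigma i)) ->
  (rkg sigma al <= rkg w (mfactor w k + mlift k al)%MM)%N.
Proof.
move=> hsigma.
have psi_gen : map_mx psi (gen n.+1) = border k (gen n).
  by apply: ysubst_gen; apply: border_low; apply: gen_low.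
apply: (rk_pattern hsigma (psi := psi)) => // [z f|x].
  by rewrite [LHS]ysubst_scale mul_mpolyC.
set m := minor _ _ _ _; suff m0 : m != 0.
  by move/eqP; rewrite mulf_eq0 (negbTE m0) => /eqP.
rewrite /m -psi_gen -rmorph_minor minor_gen_diag rmorph_prod; apply/prodf_neq0 => s _.
have := congr1 (fun M : 'M_n.+1 => M s s) psi_gen; rewrite !mxE => ->.
by case: (unliftP k s) => [s' _|_]; rewrite ?oner_neq0 // gen_diag.
Qed.

End Specialization.

(* w in S_{n+1}, k in [n+1]; sigma in S_n is the standardization of
   w_1 ... \hat{w_k} ... w_{n+1}: w(lift k i) = lift (w k) (sigma i). *)
Theorem theorem1p2 (n : nat) (w : 'S_n.+1) (k : 'I_n.+1) (sigma : 'S_n)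
  (hsigma : forall i : 'I_n, w (lift k i) = lift (w k) (sigma i)) :
  exists F : {mpoly int[n.+1]},
    (forall m, 0 <= F@_m) /\
    schubert w = Mfactor w k * skipvar k (schubert sigma) + F.
Proof.
exists (schubert w - Mfactor w k * skipvar k (schubert sigma)); split; last by rewrite addrC subrK.
move=> m; rewrite mcoeffB subr_ge0 MfactorE skipvarE mulr_sumr raddf_sum /=.
have E al : ('X_[mfactor w k] * ((schubert sigma)@_al *: 'X_[mlift k al]))@_m =
    (schubert sigma)@_al * ((mfactor w k + mlift k al)%MM == m)%:R.
  by rewrite -scalerAr -mpolyXD mcoeffZ mcoeffX.
under eq_bigr => al _ do rewrite E.
(* At most one exponent al of S_sigma is carried to m, since [mlift] is injective. If there is one,
   two ranks are compared; if there is none, it is enough that a coefficient of S_w is a rank and so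
   nonnegative. *)
case: (pickP (fun i : 'I_(size (msupp (schubert sigma))) =>
   (mfactor w k + mlift k (nth 0%MM (msupp (schubert sigma)) i))%MM == m)) => [i /eqP ei|no].
  set al := nth _ _ _ in ei.
  have alS : al \in msupp (schubert sigma) by apply: mem_nth.
  rewrite (bigD1_seq al) ?msupp_uniq //= ei eqxx mulr1 big1 ?addr0.
    by rewrite !schub_rkg lez_nat -ei; apply: rkg_pattern.
  move=> be ne; case: eqP => [e|_]; last by rewrite mulr0.
  by move: e; rewrite -ei => /addmI/mlift_inj e; rewrite e eqxx in ne.
rewrite big_seq big1 ?schub_rkg // => al alS.
move/nthP: alS => /(_ 0%MM)[i hi <-]; have := no (Ordinal hi) => /= ->.
by rewrite mulr0.
Qed.
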